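(* Assume that there exists $\lambda_0\in\bigcap_{n\in\mathbb{N}}\rho(T_n)\cap\rho(T)$ such that, strongly in $H_0$ as $n\to\infty$, $$T_n(\lambda_0)^{-1}P_n\to T(\lambda_0)^{-1}P,\qquad T_n(\lambda_0)^{-*}P_n\to T(\lambda_0)^{-*}P.$$ If also $A_{j,n}P_n\to A_jP$ and $A_{j,n}^*P_n\to A_j^*P$ strongly for every $j=1,\dots,M$, then spectral pollution, i.e. the set $$\{\lambda\in\rho(T):\exists\,\lambda_n\in\sigma(T_n),\ \lambda_n\to\lambda\},$$ is contained in $$\sigma_e\big((T_n)_{n\in\mathbb{N}}\big)\cup\sigma_e\big((T_n^* )_{n\in\mathbb{N}}\big)^*,$$ and for every isolated $\lambda\in\sigma_p(T)$ (isolated as a point of $\sigma(T)$) not belonging to $\sigma_e\big((T_n)_{n\in\mathbb{N}}\big)\cup\sigma_e\big((T_n^* )_{n\in\mathbb{N}}\big)^*$ there exist $\lambda_n\in\sigma(T_n)$, $n\in\mathbb{N}$, with $\lambda_n\to\lambda$.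
   Context: $H_0$ is a Hilbert space, $H,H_n\subset H_0$ ($n\in\mathbb{N}$) are closed subspaces, $P:H_0\to H$ and $P_n:H_0\to H_n$ are the orthogonal projections, and $P_n\to P$ strongly. Fix $M\in\mathbb{N}$. $A_j$, $j=0,\dots,M$, are densely defined operators in $H$, and $A_{j,n}$, $j=0,\dots,M$, are densely defined operators in $H_n$. For $j\ne0$ the $A_j$ are bounded (everywhere defined) and the $A_{j,n}$ are bounded uniformly in $n$; only $A_0$, $A_{0,n}$ may be unbounded. There is a ray $\mathrm{e}^{\mathrm{i}\gamma}(-\infty,c)\subset\bigcap_{n}\rho(A_{0,n})\cap\rho(A_0)$ with $c\in\mathbb{R}$, $\gamma\in(-\pi,\pi]$ such that, with $t=\mathrm{e}^{\mathrm{i}\gamma}s$, $\lim_{s\to-\infty}\|(A_0-t)^{-1}\|=0$ and $\lim_{s\to-\infty}\sup_{n}\|(A_{0,n}-t)^{-1}\|=0$. Pencils: $T(\lambda)=\sum_{j=0}^M\lambda^jA_j$, $\operatorname{dom}T(\lambda)=\operatorname{dom}A_0$, in $H$; $T_n(\lambda)=\sum_{j=0}^M\lambda^jA_{j,n}$, $\operatorname{dom}(T_n):=\operatorname{dom}T_n(\lambda)=\operatorname{dom}A_{0,n}$, in $H_n$; $T^*(\lambda):=T(\overline\lambda)^*$, $T_n^*(\lambda):=T_n(\overline\lambda)^*$. $T(\lambda)^{-*}$ denotes $(T(\lambda)^{-1})^*$, and likewise for $T_n$. Operators $B_nP_n$ with values in $H_n$ are regarded as having values in $H_0$. For a pencil,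 $\rho$ is the set of $\lambda\in\mathbb{C}$ where it is boundedly invertible, $\sigma$ its complement, and $\sigma_p(T)=\{\lambda:\ker T(\lambda)\neq\{0\}\}$. For $S\subset\mathbb{C}$, $S^*=\{\overline\lambda:\lambda\in S\}$. Limiting essential spectrum: $\sigma_e((T_n)_{n\in\mathbb{N}})$ is the set of $\lambda\in\mathbb{C}$ for which there are an infinite $I\subset\mathbb{N}$ and $x_n\in\operatorname{dom}(T_n)$, $\|x_n\|=1$, $n\in I$, with $x_n\rightharpoonup0$ in $H_0$ and $\|T_n(\lambda)x_n\|\to0$ (as $n\in I$, $n\to\infty$); analogously for $(T_n^* )_{n\in\mathbb{N}}$.
   Formalization: The sequence λ_n is required to lie in σ(T_n) only for all sufficiently large n (in both conclusions), since σ(T_n) may be empty for finitely many n, which makes the second claim false if every n is required. *)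

(* Defs.v *)
From HB Require Import structures.
From mathcomp Require Import all_boot all_order all_algebra.
From mathcomp Require Import complex.
From mathcomp Require Import all_classical all_reals all_analysis.

Set Implicit Arguments.
Unset Strict Implicit.
Unset Printing Implicit Defensive.

Import Order.TTheory GRing.Theory Num.Theory Num.Def.
Import numFieldNormedType.Exports.

Local Open Scope classical_set_scope.
Local Open Scope ring_scope.

(* The complex numbers, named so that the canonical topology and norm of a
   [numClosedFieldType] are found; they are not inferred for [R[i]] itself. *)
Definition C (R : realType) : numClosedFieldType := R[i].

(* e^{i gamma} * s *)
Definition ray_point (R : realType) (gamma s : R) : C R :=
  (cos gamma +i* sin gamma)%C * (s%:C)%C.

Definition linear_subspace (R : realType) (V : normedModType (C R))
    (H : set V) :=
  H 0 /\ forall (a : C R) (x y : V), H x -> H y -> H (a *: x + y).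

Definition orthogonal_projection (R : realType) (V : normedModType (C R))
    (dot : {dot V for conjC}) (H : set V) (P : V -> V) :=
  forall x, H (P x) /\ forall z, H z -> dot (x - P x) z = 0.

(* A possibly unbounded operator: the values of [app] outside [dom] are junk,
   and no notion below depends on them. *)
Record operator (V : Type) := Operator { dom : set V ; app :> V -> V }.

Definition densely_defined_in (R : realType) (V : normedModType (C R))
    (H : set V) (A : operator V) :=
  [/\ linear_subspace (dom A),
      dom A `<=` H,
      H `<=` closure (dom A),
      forall x, dom A x -> H (A x) &
      forall (a : C R) (x y : V), dom A x -> dom A y ->
        A (a *: x + y) = a *: A x + A y].

(* Norms in [V] are elements of [C R] with zero imaginary part. *)
Definition opnorm (R : realType) (V : normedModType (C R)) (A : operator V) :
    \bar R :=
  ereal_sup [set (complex.Re `|A x|)%:E | x in [set x | dom A x /\ `|x| <= 1]].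

Definition inverse (V : nmodType) (A : operator V) : operator V :=
  Operator (A @` dom A) ('pinv_(fun=> 0) (dom A) A).

(* The adjoint of [A] as an operator in the Hilbert space [H]; [z = A^* y] is
   unique when [A] is densely defined in [H]. *)
Definition adjoint_rel (R : realType) (V : normedModType (C R))
    (dot : {dot V for conjC}) (H : set V) (A : operator V) (y z : V) :=
  [/\ H y, H z & forall x, dom A x -> dot (A x) y = dot x z].

Definition adjoint (R : realType) (V : normedModType (C R))
    (dot : {dot V for conjC}) (H : set V) (A : operator V) : operator V :=
  Operator [set y | exists z, adjoint_rel dot H A y z]
           (fun y => xget 0 [set z | adjoint_rel dot H A y z]).

Definition boundedly_invertible (R : realType) (V : normedModType (C R))
    (H : set V) (A : operator V) :=
  set_bij (dom A) H A /\ (opnorm (inverse A) < +oo)%E.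

Definition pencil (R : realType) (V : normedModType (C R)) (M : nat)
    (A : 'I_M.+1 -> operator V) (lambda : C R) : operator V :=
  Operator (dom (A ord0)) (fun x => \sum_(j < M.+1) lambda ^+ j *: A j x).

Definition adjoint_pencil (R : realType) (V : normedModType (C R))
    (dot : {dot V for conjC}) (H : set V) (T : C R -> operator V)
    (lambda : C R) : operator V :=
  adjoint dot H (T (conjC lambda)).

Definition resolvent_set (R : realType) (V : normedModType (C R))
    (H : set V) (T : C R -> operator V) : set (C R) :=
  [set lambda | boundedly_invertible H (T lambda)].

Definition spectrum (R : realType) (V : normedModType (C R))
    (H : set V) (T : C R -> operator V) : set (C R) :=
  ~` resolvent_set H T.

Definition point_spectrum (R : realType) (V : normedModType (C R))
    (T : C R -> operator V) : set (C R) :=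
  [set lambda | exists2 x, x != 0 & dom (T lambda) x /\ T lambda x = 0].

(* The pencil t |-> A - t; its resolvent set is that of the operator [A]. *)
Definition operator_pencil (R : realType) (V : normedModType (C R))
    (A : operator V) (t : C R) : operator V :=
  Operator (dom A) (fun x => A x - t *: x).

Definition strong_cvg (R : realType) (V : normedModType (C R))
    (F : nat -> V -> V) (G : V -> V) :=
  forall x, F n x @[n --> \oo] --> G x.

(* [within I \oo] is the filter of n -> oo, n in I. *)
Definition limiting_essential_spectrum (R : realType)
    (V : normedModType (C R)) (dot : {dot V for conjC})
    (Tn : nat -> C R -> operator V) : set (C R) :=
  [set lambda | exists I : set nat, exists x : nat -> V,
    [/\ infinite_set I,
        forall n, I n -> dom (Tn n lambda) (x n) /\ `|x n| = 1,
        forall y, dot (x n) y @[n --> within I \oo] --> (0 : C R) &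
        `|Tn n lambda (x n)| @[n --> within I \oo] --> (0 : C R)]].

(* The limits of sequences lambda_n in sigma(T_n). As sigma(T_n) may be empty
   for finitely many n, lambda_n is only required to lie in sigma(T_n) for all
   sufficiently large n. *)
Definition spectral_limits (R : realType) (V : normedModType (C R))
    (Hn : nat -> set V) (Tn : nat -> C R -> operator V) : set (C R) :=
  [set lambda | exists2 lambdan : nat -> C R,
     \forall n \near \oo, spectrum (Hn n) (Tn n) (lambdan n) &
     lambdan n @[n --> \oo] --> lambda].

Definition spectral_pollution (R : realType) (V : normedModType (C R))
    (H : set V) (Hn : nat -> set V) (T : C R -> operator V)
    (Tn : nat -> C R -> operator V) : set (C R) :=
  resolvent_set H T `&` spectral_limits Hn Tn.

(* Main.v *)
Require Import Defs.
From HB Require Import structures.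
From mathcomp Require Import all_boot all_order all_algebra.
From mathcomp Require Import complex.
From mathcomp Require Import all_classical all_reals all_analysis.
From mathcomp Require Import ring lra.

Set Implicit Arguments.
Unset Strict Implicit.
Unset Printing Implicit Defensive.

Import Order.TTheory GRing.Theory Num.Theory Num.Def.
Import numFieldNormedType.Exports.

Local Open Scope classical_set_scope.
Local Open Scope ring_scope.

(** Write [T] for the limit pencil, [T_n] for the approximating ones, and say
    that the [T_n lam] have approximate kernels if there are unit vectors [x_n]
    with [T_n lam x_n --> 0] along infinitely many [n]; [lam] lies in the limiting
    essential spectrum when such [x_n] can moreover be chosen weakly null.

    The strong convergence of the resolvents at [lam0], of the bounded
    coefficients and of their adjoints gives graph approximations: every [x] in
    the domain of [T] is a limit of [x_n] in the domains of the [T_n] with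
    [T_n lam x_n --> T lam x] for all [lam], and likewise for the adjoints
    ([graph_approximation], [adjoint_graph_approximation]).  If [T lam] is boundedly
    invertible, every vector of [H] is in the range of the adjoint of [T lam], and
    pairing an approximate kernel sequence with the approximations of its preimage
    shows that the sequence is weakly null ([weak_control]).  Hence, at regular
    points of [T] outside the limiting essential spectrum, the [T_n lam] are
    bounded below, uniformly in late [n] ([weakly_controlled_lower_bound]).

    Pollution: when this holds both for the pencils and for their adjoints at
    [lam], it persists for nearby spectral parameters, because pencils depend on
    the parameter through bounded coefficients only; an operator that is bounded
    below, with closed range and trivial orthogonal complement of the range, is
    boundedly invertible ([boundedly_invertible_near]), so spectral points of the
    [T_n] cannot converge to [lam] ([no_pollution]).

    Eigenvalues: let [lam] be an isolated eigenvalue outside the limiting essential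
    spectrum and suppose that a disc around it misses the spectrum of infinitely
    many [T_n].  The finitary form [approximately_singular] of the limiting essential
    spectrum defines a closed set ([not_singular_open]), so the lower bounds are
    available, and by compactness uniform, on the boundary of a small square around
    [lam].  The resolvent of those [T_n] is holomorphic in the
    square, and the maximum principle ([resolvent_maximum_principle]) carries the
    bound to the centre.  A graph approximation of an eigenvector then consists of
    vectors tending to zero, which is absurd ([eigenvalue_approximation]). *)

(** * Real-valued norms *)

Section RealNorm.
Context {R : realType}.
Implicit Types V : normedModType (C R).

(** The norm of a complex normed space is a complex number with zero imaginary
    part; its real part lives in a totally ordered field. *)
Definition nrm (V : normedZmodType (C R)) (x : V) : R := complex.Re `|x|.

Lemma nrmE (V : normedZmodType (C R)) (x : V) : `|x| = ((nrm x)%:C)%C :> C R.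
Proof.
have : (0 : C R) <= `|x| by [].
rewrite /nrm; case: (`|x| : R[i]) => a b.
by rewrite lecE /= => /andP[/eqP -> _].
Qed.

Lemma ltc_real (a b : R) : ((a%:C)%C < (b%:C)%C :> C R) = (a < b).
Proof. exact: ltcR. Qed.
Lemma lec_real (a b : R) : ((a%:C)%C <= (b%:C)%C :> C R) = (a <= b).
Proof. exact: lecR. Qed.

Lemma realI (a b : R) : (a%:C)%C = (b%:C)%C :> C R -> a = b.
Proof. exact: complexI. Qed.

Lemma realD (a b : R) : ((a + b)%:C)%C = (a%:C)%C + (b%:C)%C :> C R.
Proof. exact: rmorphD. Qed.
Lemma realM (a b : R) : ((a * b)%:C)%C = (a%:C)%C * (b%:C)%C :> C R.
Proof. exact: rmorphM. Qed.
Lemma realX (a : R) n : ((a ^+ n)%:C)%C = (a%:C)%C ^+ n :> C R.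
Proof. exact: rmorphXn. Qed.
Lemma real_nat n : ((n%:R : R)%:C)%C = n%:R :> C R.
Proof. exact: rmorph_nat. Qed.

Lemma nrm_ge0 (V : normedZmodType (C R)) (x : V) : 0 <= nrm x.
Proof. by rewrite -lec_real -nrmE normr_ge0. Qed.

Lemma nrm0 (V : normedZmodType (C R)) : nrm (0 : V) = 0.
Proof. by rewrite /nrm normr0. Qed.

Lemma nrm_eq0 (V : normedZmodType (C R)) (x : V) : nrm x = 0 -> x = 0.
Proof. by move=> h; apply: normr0_eq0; rewrite nrmE h. Qed.

Lemma nrm_gt0 (V : normedZmodType (C R)) (x : V) : x != 0 -> 0 < nrm x.
Proof. by move=> x0; rewrite -ltc_real -nrmE normr_gt0. Qed.

Lemma nrmD (V : normedZmodType (C R)) (x y : V) : nrm (x + y) <= nrm x + nrm y.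
Proof. by rewrite -lec_real rmorphD /= -!nrmE ler_normD. Qed.

Lemma nrmN (V : normedZmodType (C R)) (x : V) : nrm (- x) = nrm x.
Proof. by rewrite /nrm normrN. Qed.

Lemma nrmB (V : normedZmodType (C R)) (x y : V) : nrm (x - y) <= nrm x + nrm y.
Proof. by rewrite -(nrmN y) nrmD. Qed.

Lemma nrm_distC (V : normedZmodType (C R)) (x y : V) : nrm (x - y) = nrm (y - x).
Proof. by rewrite /nrm distrC. Qed.

Lemma nrm_lip (V : normedZmodType (C R)) (x y : V) : `|nrm x - nrm y| <= nrm (x - y).
Proof.
have h1 := nrmD (x - y) y; have h2 := nrmD (y - x) x.
rewrite !subrK in h1 h2; rewrite nrm_distC in h2.
by rewrite ler_norml; apply/andP; split; lra.
Qed.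

Lemma nrmZ V (a : C R) (x : V) : nrm (a *: x) = nrm a * nrm x.
Proof. by apply: complexI; rewrite rmorphM /= -!nrmE normrZ. Qed.

Lemma nrmM (a b : C R) : nrm (a * b) = nrm a * nrm b.
Proof. by apply: complexI; rewrite rmorphM /= -!nrmE normrM. Qed.

Lemma nrmX (a : C R) n : nrm (a ^+ n) = nrm a ^+ n.
Proof. by apply: realI; rewrite realX -!nrmE normrX. Qed.

Lemma nrm_conj (a : C R) : nrm (conjC a) = nrm a.
Proof. by rewrite /nrm norm_conjC. Qed.

Lemma nrm_real (a : R) : nrm ((a%:C)%C : C R) = `|a|.
Proof. by rewrite /nrm /= expr0n addr0 sqrtr_sqr. Qed.

Lemma nrm_sum (V : normedZmodType (C R)) (I : Type) (r : seq I) (Q : pred I) (F : I -> V) :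
  nrm (\sum_(i <- r | Q i) F i) <= \sum_(i <- r | Q i) nrm (F i).
Proof.
elim/big_ind2 : _ => [|x a y b xa yb|//]; first by rewrite nrm0.
exact: le_trans (nrmD _ _) (lerD xa yb).
Qed.

Lemma cvg_nrmP (V : pseudoMetricNormedZmodType (C R)) (T : Type) (F : set_system T)
    {FF : Filter F} (u : T -> V) (l : V) :
  (u t @[t --> F] --> l) <-> (nrm (u t - l) @[t --> F] --> (0 : R)).
Proof.
split=> [/cvgrPdist_lt h|/cvgrPdist_lt h]; apply/cvgrPdist_lt => e e0.
- have e0' : (0 : C R) < (e%:C)%C by rewrite (ltc_real 0).
  have := h _ e0'; apply: filterS => t.
  by rewrite nrmE ltc_real sub0r normrN ger0_norm ?nrm_ge0// nrm_distC.
- have e0' := e0; move: e0'; rewrite ltcE /= => /andP[/eqP eI eR].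
  have := h _ eR; apply: filterS => t.
  rewrite sub0r normrN ger0_norm ?nrm_ge0// nrm_distC nrmE.
  by case: e e0 eI eR => a b /= _ -> _; rewrite ltc_real.
Qed.

Lemma cvg0_le (T : Type) (F : set_system T) {FF : Filter F} (u v : T -> R) :
  (forall t, 0 <= u t <= v t) -> v t @[t --> F] --> (0 : R) ->
  u t @[t --> F] --> (0 : R).
Proof.
by move=> uv v0; apply: (squeeze_cvgr _ (cvg_cst 0) v0); exact: nearW.
Qed.

Lemma cvg0D (T : Type) (F : set_system T) {FF : Filter F} (u v : T -> R) :
  u t @[t --> F] --> (0 : R) -> v t @[t --> F] --> (0 : R) ->
  u t + v t @[t --> F] --> (0 : R).
Proof. by move=> u0 v0; rewrite -[X in _ --> X]addr0; exact: cvgD. Qed.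

Lemma cvg0Ml (T : Type) (F : set_system T) {FF : Filter F} (K : R) (u : T -> R) :
  u t @[t --> F] --> (0 : R) -> K * u t @[t --> F] --> (0 : R).
Proof.
move=> u0; rewrite -[X in _ --> X](mulr0 K).
by apply: cvgM => //; exact: cvg_cst.
Qed.

Lemma cvg0_near (T : Type) (F : set_system T) {FF : Filter F} (u : T -> R) (e : R) :
  0 < e -> u t @[t --> F] --> (0 : R) -> \forall t \near F, u t < e.
Proof.
move=> e0 /cvgrPdist_lt/(_ _ e0); apply: filterS => t.
by rewrite sub0r normrN; apply: le_lt_trans; exact: ler_norm.
Qed.

Lemma cvg0_nearP (T : Type) (F : set_system T) {FF : Filter F} (u : T -> R) :
  (forall t, 0 <= u t) -> (forall e, 0 < e -> \forall t \near F, u t < e) ->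
  u t @[t --> F] --> (0 : R).
Proof.
move=> u_ge0 h; apply/cvgrPdist_lt => e /h; apply: filterS => t.
by rewrite sub0r normrN ger0_norm.
Qed.

End RealNorm.

(** * Orthogonal projections and Riesz representation *)

Section Hilbert.
Context {R : realType} {H0 : completeNormedModType (C R)}
  {dot : {dot H0 for conjC}}.
Context (dot_norm : forall x : H0, `|x| ^+ 2 = dot x x).
Implicit Types (x y z : H0) (W : set H0).

Lemma dotC x y : dot y x = conjC (dot x y).
Proof. by rewrite hermC expr0 mul1r. Qed.

Lemma dotDl x y z : dot (x + y) z = dot x z + dot y z.
Proof. exact: linearDl. Qed.
Lemma dotDr x y z : dot x (y + z) = dot x y + dot x z.
Proof. exact: linearDr. Qed.
Lemma dotBl x y z : dot (x - y) z = dot x z - dot y z.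
Proof. exact: linearBl. Qed.
Lemma dotBr x y z : dot x (y - z) = dot x y - dot x z.
Proof. exact: linearBr. Qed.
Lemma dotZl a x y : dot (a *: x) y = a * dot x y.
Proof. exact: linearZl_LR. Qed.
Lemma dotZr a x y : dot x (a *: y) = conjC a * dot x y.
Proof. exact: linearZr_LR. Qed.

Lemma dot_nrm x : dot x x = ((nrm x ^+ 2)%:C)%C.
Proof. by rewrite rmorphXn /= -nrmE dot_norm. Qed.

(** The identity behind both the Cauchy-Schwarz inequality and the
    characterization of projections. *)
Lemma dot_proj x z (t := dot x z / dot z z) : z != 0 ->
  dot (x - t *: z) (x - t *: z) = dot x x - `|dot x z| ^+ 2 / dot z z.
Proof.
move=> z0; have b0 : 0 < dot z z by rewrite dnorm_gt0.
rewrite !(dotBl, dotBr, dotZl, dotZr).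
rewrite (dotC x z) /t rmorphM /= fmorphV /= (CrealP (gtr0_real b0)) normCK.
by field; rewrite gt_eqF.
Qed.

Lemma nrm_dot_le x y : nrm (dot x y) <= nrm x * nrm y.
Proof.
have [->|y0] := eqVneq y 0; first by rewrite linear0r !nrm0 mulr0.
have b0 : 0 < dot y y by rewrite dnorm_gt0.
have := dnorm_ge0 dot (x - (dot x y / dot y y) *: y).
rewrite dot_proj// subr_ge0 ler_pdivrMr// !dot_nrm nrmE -rmorphXn -rmorphM.
by rewrite lec_real -exprMn (@ler_pXn2r _ 2) ?nnegrE ?mulr_ge0 ?nrm_ge0.
Qed.

Lemma parallelogram x y :
  nrm (x + y) ^+ 2 + nrm (x - y) ^+ 2 = 2 * (nrm x ^+ 2 + nrm y ^+ 2).
Proof.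
apply: realI; rewrite realM real_nat !realD -!dot_nrm.
by rewrite !(dotBl, dotBr, dotDl, dotDr); ring.
Qed.

(** Completeness arguments only use closedness along sequences, which is also what
    a lower bound for an operator yields for its range. *)
Definition seq_closed W :=
  forall (u : nat -> H0) l, (forall n, W (u n)) -> u @ \oo --> l -> W l.

Lemma closed_seq_closed W : closed W -> seq_closed W.
Proof. by move=> cW u l Wu ul; apply: (closed_cvg W) ul => //; exact: nearW. Qed.

Lemma cauchy_nrm_cvg (u : nat -> H0) :
  (forall e : R, 0 < e -> exists N, forall n, (N <= n)%N -> nrm (u N - u n) < e) ->
  exists l : H0, u @ \oo --> l.
Proof.
move=> h; suff : cvg (u @ \oo) by move=> c; exists (lim (u @ \oo)).
apply: cauchy_cvg; apply: cauchy_exP => e.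
rewrite ltcE /= => /andP[/eqP eI eR].
have [N hN] := h _ eR; exists (u N); exists N => // n /= Nn.
rewrite -ball_normE /= nrmE.
by move: eI eR hN; case: e => a b /= -> _ hN; rewrite ltc_real hN.
Qed.

Lemma subspaceD W x y : linear_subspace W -> W x -> W y -> W (x + y).
Proof. by move=> [_ h] Wx Wy; have := h 1 _ _ Wx Wy; rewrite scale1r. Qed.

Lemma subspaceZ W a x : linear_subspace W -> W x -> W (a *: x).
Proof. by move=> [W0 h] Wx; have := h a _ _ Wx W0; rewrite addr0. Qed.

Lemma subspaceB W x y : linear_subspace W -> W x -> W y -> W (x - y).
Proof.
move=> sW Wx Wy; apply: subspaceD => //.
by rewrite -scaleN1r; exact: subspaceZ.
Qed.

(** Otherwise subtracting from [x] its component along [z] would make it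
    shorter. *)
Lemma min_orthogonal W x : linear_subspace W ->
  (forall z, W z -> nrm x <= nrm (x - z)) -> forall z, W z -> dot x z = 0.
Proof.
move=> sW xmin z Wz; have [->|z0] := eqVneq z 0; first by rewrite linear0r.
have b0 : 0 < dot z z by rewrite dnorm_gt0.
have : nrm x ^+ 2 <= nrm (x - (dot x z / dot z z) *: z) ^+ 2.
  by rewrite (@ler_pXn2r _ 2) ?nnegrE ?nrm_ge0// xmin//; exact: subspaceZ.
rewrite -lec_real -!dot_nrm dot_proj// lerBrDl gerDr pmulr_lle0 ?invr_gt0// => h.
by apply/eqP; rewrite -normr_eq0 -sqrf_eq0 eq_le h exprn_ge0.
Qed.

Lemma nrm_dist_cvg (u : nat -> H0) l v : u @ \oo --> l ->
  nrm (v - u n) @[n --> \oo] --> nrm (v - l).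
Proof.
move=> /cvg_nrmP/cvgrPdist_lt ul; apply/cvgrPdist_lt => e /ul.
apply: filterS => n; rewrite sub0r normrN ger0_norm ?nrm_ge0//.
apply: le_lt_trans.
apply: le_trans (nrm_lip _ _) _.
by rewrite opprB addrC addrA subrK.
Qed.

(** The orthogonal projection of [v] is the limit of a minimizing sequence for
    the distance to [W]; the parallelogram law makes such a sequence Cauchy. *)
Lemma projection_theorem W v : linear_subspace W -> seq_closed W ->
  exists2 w, W w & forall z, W z -> dot (v - w) z = 0.
Proof.
move=> sW cW; pose S := [set nrm (v - w) ^+ 2 | w in W].
have S0 : has_inf S.
  split; first by exists (nrm (v - 0) ^+ 2); exists 0 => //; case: sW.
  by exists 0 => _ [w _ <-]; rewrite exprn_ge0 ?nrm_ge0.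
have infS w : W w -> inf S <= nrm (v - w) ^+ 2.
  by move=> Ww; apply: ge_inf; [case: S0|exists w].
have /choice[u uP] : forall n, exists w, W w /\ nrm (v - w) ^+ 2 < inf S + n.+1%:R^-1.
  move=> n; have n0 : (0 : R) < n.+1%:R^-1 by rewrite invr_gt0.
  by have [_ [w Ww <-] ?] := inf_adherent n0 S0; exists w.
have Cu m n : nrm (u m - u n) ^+ 2 <= 2 * (m.+1%:R^-1 + n.+1%:R^-1).
  have [Wm hm] := uP m; have [Wn hn] := uP n.
  have := parallelogram (v - u m) (v - u n).
  have -> : v - u m - (v - u n) = u n - u m by rewrite opprB addrC addrA subrK.
  have -> : v - u m + (v - u n) = 2 *: (v - 2^-1 *: (u m + u n)).
    by rewrite scalerBr scalerA mulfV ?pnatr_eq0// scale1r scaler_nat mulr2n opprD addrACA.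
  rewrite nrmZ exprMn (nrm_distC (u n)).
  have -> : nrm (2 : C R) = 2.
    by apply: realI; rewrite -nrmE normr_nat real_nat.
  have : inf S <= nrm (v - 2^-1 *: (u m + u n)) ^+ 2.
    by apply: infS; apply: subspaceZ => //; exact: subspaceD.
  move: hm hn; rewrite [2 ^+ 2]expr2.
  move: (m.+1%:R^-1) (n.+1%:R^-1) (nrm _ ^+ 2) (nrm _ ^+ 2) (nrm _ ^+ 2) (nrm _ ^+ 2).
  move=> *; lra.
have [l ul] : exists l : H0, u @ \oo --> l.
  apply: cauchy_nrm_cvg => e e0.
  have e2 : 0 < e ^+ 2 / 4 by rewrite divr_gt0 ?exprn_gt0.
  have [N _ hN] := near_infty_natSinv_lt (PosNum e2).
  exists N => n Nn; rewrite -(@ltr_pXn2r _ 2) ?nnegrE ?nrm_ge0 ?(ltW e0)//.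
  apply: le_lt_trans (Cu _ _) _.
  have /= h1 := hN N (leqnn N); have /= h2 := hN n Nn.
  move: h1 h2; move: (N.+1%:R^-1) (n.+1%:R^-1) (e ^+ 2) => *; lra.
exists l; first by apply: cW ul => n; case: (uP n).
apply: min_orthogonal => // z Wz.
rewrite -(@ler_pXn2r _ 2) ?nnegrE ?nrm_ge0//.
apply: (@le_trans _ _ (inf S)); last first.
  rewrite -addrA -opprD; apply: infS; apply: subspaceD => //.
  by apply: cW ul => n; case: (uP n).
have lim1 : nrm (v - u n) ^+ 2 @[n --> \oo] --> nrm (v - l) ^+ 2.
  exact: continuous_cvg _ (@exprn_continuous R 2 _) (@nrm_dist_cvg u l v ul).
have lim2 : inf S + n.+1%:R^-1 @[n --> \oo] --> inf S.
  by rewrite -[X in _ --> X]addr0; apply: cvgD; [exact: cvg_cst|exact: cvg_harmonic].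
apply: (ler_cvg_to lim1 lim2).
by apply: nearW => n; apply: ltW; case: (uP n).
Qed.

(** A bounded functional is a multiple of the inner product with a vector
    orthogonal to its kernel. *)
Lemma riesz W (phi : H0 -> C R) (K : R) : linear_subspace W -> seq_closed W ->
  (forall a x y, W x -> W y -> phi (a *: x + y) = a * phi x + phi y) ->
  (forall x, W x -> nrm (phi x) <= K * nrm x) ->
  exists2 z, W z & forall x, W x -> phi x = dot x z.
Proof.
move=> sW cW lin bd.
have [phi0|] := pselect (forall x, W x -> phi x = 0).
  by exists 0; [case: sW|move=> x Wx; rewrite phi0// linear0r].
move=> /existsNP[v /not_implyP[Wv phiv]].
have phi00 : phi 0 = 0.
  have W0 : W 0 by case: sW.
  by have := lin (-1) 0 0 W0 W0; rewrite scaler0 addr0 mulN1r addNr.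
have phiB x y : W x -> W y -> phi (x - y) = phi x - phi y.
  move=> Wx Wy; have := lin (-1) y x Wy Wx.
  by rewrite scaleN1r mulN1r addrC => ->; rewrite addrC.
have phiZ a x : W x -> phi (a *: x) = a * phi x.
  have W0 : W 0 by case: sW.
  by move=> Wx; rewrite -[a *: x]addr0 lin// phi00 addr0.
pose ker := [set x | W x /\ phi x = 0].
have sker : linear_subspace ker.
  split=> [|a x y [Wx x0] [Wy y0]]; first by split=> //; case: sW.
  by split; [case: sW => _; apply|rewrite lin// x0 y0 mulr0 addr0].
have cker : seq_closed ker.
  move=> u l ku ul; have Wl : W l by apply: cW ul => n; case: (ku n).
  split=> //; apply: nrm_eq0; apply/eqP; rewrite eq_le nrm_ge0 andbT.
  have /cvg_nrmP ul0 := ul.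
  have lim : K * nrm (u n - l) @[n --> \oo] --> (0 : R).
    by rewrite -[X in _ --> X](mulr0 K); apply: cvgM ul0; exact: cvg_cst.
  apply: (cvgr_to_ge lim).
  apply: nearW => n; have [Wn un0] := ku n.
  rewrite nrm_distC -[X in nrm X <= _]subr0 -un0 -phiB//; apply: bd.
  exact: subspaceB.
have [p [Wp p0] pP] := projection_theorem v sker cker.
set g := v - p in pP.
have Wg : W g by exact: subspaceB.
have phig : phi g = phi v by rewrite phiB// p0 subr0.
have g0 : dot g g != 0.
  rewrite dnorm_eq0; apply: contra_notN phiv => /eqP g0.
  by rewrite -phig g0.
exists (conjC (phi g / dot g g) *: g); first exact: subspaceZ.
move=> x Wx; rewrite dotZr conjCK.
have : dot (phi g *: x - phi x *: g) g = 0.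
  rewrite dotC pP ?conjC0//; split; first by apply: subspaceB => //; exact: subspaceZ.
  by rewrite (phiB (phi g *: x))// ?phiZ 1?mulrC ?subrr//; exact: subspaceZ.
rewrite dotBl !dotZl => /subr0_eq h.
by apply: (mulIf g0); rewrite [RHS]mulrAC divfK// h.
Qed.
End Hilbert.

(** * Limiting essential spectra *)

Section WeakSequences.
Context {R : realType} {H0 : completeNormedModType (C R)}
  {dot : {dot H0 for conjC}}.
Context (dot_norm : forall x : H0, `|x| ^+ 2 = dot x x).

(** The vectors against which the sequence tends to zero form a closed subspace; it
    contains the sequence, hence also everything orthogonal to the sequence. *)
Lemma asymptotically_orthogonal_weak0 (z : nat -> H0) :
  (forall k, nrm (z k) <= 1) ->
  (forall j, nrm (dot (z k) (z j)) @[k --> \oo] --> (0 : R)) ->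
  forall y, nrm (dot (z k) y) @[k --> \oo] --> (0 : R).
Proof.
move=> z1 zz; pose Y := [set y | nrm (dot (z k) y) @[k --> \oo] --> (0 : R)].
have sY : linear_subspace Y.
  split=> [|a x y Yx Yy]; rewrite /Y /=.
    under eq_fun do rewrite linear0r nrm0; exact: cvg_cst.
  apply: (cvg0_le _ (cvg0D (cvg0Ml (nrm a) (Yx : _ --> (0 : R)))
                           (Yy : _ --> (0 : R)))) => k.
  by rewrite nrm_ge0 dotDr dotZr -(nrm_conj a) -nrmM nrmD.
have cY : seq_closed Y.
  move=> u l Yu /cvg_nrmP ul; apply: cvg0_nearP => [k|e e0]. exact: nrm_ge0.
  have e2 : 0 < e / 2 by rewrite divr_gt0.
  have [N _ /(_ N (leqnn N)) /= uN] := cvg0_near e2 ul.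
  have : \forall k \near \oo, nrm (dot (z k) (u N)) < e / 2.
    exact: cvg0_near (Yu N).
  apply: filterS => k zk.
  have -> : dot (z k) l = dot (z k) (u N) - dot (z k) (u N - l).
    by rewrite dotBr; ring.
  apply: le_lt_trans (nrmB _ _) _.
  have := nrm_dot_le dot_norm (z k) (u N - l).
  have := ler_wpM2r (nrm_ge0 (u N - l)) (z1 k); lra.
move=> y; have [w Yw wP] := projection_theorem dot_norm y sY cY.
suff Yyw : Y (y - w) by have := subspaceD sY Yyw Yw; rewrite subrK.
rewrite /Y /=; have -> : (fun k => nrm (dot (z k) (y - w))) = fun=> 0.
  by apply/funext => k; rewrite (dotC (y - w)) nrm_conj wP ?nrm0//; exact: (zz k).
exact: cvg_cst.
Qed.

(** The finitary form of the limiting essential spectrum: a statement about one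
    vector at a time, and therefore stable under limits in the parameter. *)
Definition approximately_singular (S : nat -> operator H0) :=
  forall (e : R) (F : seq H0) (N : nat), 0 < e -> exists n x,
    [/\ (N <= n)%N, dom (S n) x, nrm x = 1, nrm (S n x) < e &
        forall f, f \in F -> nrm (dot x f) < e].

(** Approximate kernel vectors are chosen one after the other, each almost
    orthogonal to all its predecessors; weak convergence to zero is then automatic
    by [asymptotically_orthogonal_weak0], although [H0] may be nonseparable. *)
Lemma singular_limiting_essential_spectrum (Tn : nat -> C R -> operator H0) lam :
  approximately_singular (fun n => Tn n lam) ->
  limiting_essential_spectrum dot Tn lam.
Proof.
move=> sing.
(* [l] lists the pairs (index, vector) chosen so far. *)
pose fresh (l : seq (nat * H0)) (p : nat * H0) :=
  [/\ forall q, q \in l -> (q.1 < p.1)%N, dom (Tn p.1 lam) p.2, nrm p.2 = 1,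
      nrm (Tn p.1 lam p.2) < (size l).+1%:R^-1 &
      forall q, q \in l -> nrm (dot p.2 q.2) < (size l).+1%:R^-1].
have /choice[f fP] : forall l, exists p, fresh l p.
  move=> l; have l0 : (0 : R) < (size l).+1%:R^-1 by rewrite invr_gt0.
  have [n [x [nN dx x1 Tx xF]]] :=
    sing _ [seq q.2 | q <- l] (\max_(q <- l) q.1).+1 l0.
  exists (n, x); split => //= q ql; last by apply: xF; apply/mapP; exists q.
  by apply: leq_ltn_trans nN; rewrite (big_rem q)//= leq_maxl.
pose l := fix l k := if k is k'.+1 then f (l k') :: l k' else [::].
have size_l k : size (l k) = k by elim: k => //= k ->.
have mem_l j k : (j < k)%N -> f (l j) \in l k.
  elim: k => //= k IH; rewrite ltnS leq_eqVlt inE => /orP[/eqP->|/IH->].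
    by rewrite eqxx.
  by rewrite orbT.
pose n k := (f (l k)).1; pose z k := (f (l k)).2.
have n_lt j k : (j < k)%N -> (n j < n k)%N.
  by move=> jk; have [h _ _ _ _] := fP (l k); exact/h/mem_l.
have n_le j k : (n j <= n k)%N -> (j <= k)%N.
  by rewrite leqNgt => h; rewrite leqNgt; apply: contra h; exact: n_lt.
have n_inj : injective n.
  move=> j k jk; apply/anti_leq/andP.
  by split; apply: n_le; rewrite jk leqnn.
have /choice[x xP] : forall m, exists y, forall k, n k = m -> y = z k.
  move=> m; have [[k <-]|h] := pselect (exists k, n k = m).
    by exists (z k) => j /n_inj ->.
  by exists 0 => k nk; exfalso; apply: h; exists k.
have xn k : x (n k) = z k by exact: xP.
have sub (h : nat -> R) : h (n k) @[k --> \oo] --> (0 : R) ->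
    h m @[m --> within (range n) \oo] --> (0 : R).
  move=> hk Q Q0; have [K _ KQ] := hk Q Q0.
  exists (n K) => // m nKm [k _ nkm]; rewrite -nkm in nKm *.
  by apply: KQ; exact: n_le.
exists (range n), x; split.
- move=> /(@finite_preimage _ _ _ n)-/(_ (in2W n_inj)).
  rewrite preimage_range; exact: infinite_nat.
- move=> _ [k _ <-]; rewrite xn; have [_ dz z1 _ _] := fP (l k).
  by split=> //; rewrite nrmE z1.
- move=> y; apply/cvg_nrmP; apply: (sub (fun m => nrm (dot (x m) y - 0))).
  under eq_fun do rewrite subr0 xn.
  apply: asymptotically_orthogonal_weak0 => [k|j].
    by have [_ _ -> _ _] := fP (l k).
  apply: cvg0_nearP => [k|e e0]; first exact: nrm_ge0.
  have [K _ hK] := near_infty_natSinv_lt (PosNum e0).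
  exists (maxn K j.+1) => // k /=; rewrite geq_max => /andP[Kk jk].
  have [_ _ _ _ /(_ _ (mem_l _ _ jk))] := fP (l k); rewrite size_l => h.
  exact: lt_trans h (hK _ Kk).
- apply/cvg_nrmP; apply: (sub (fun m => nrm (`|Tn m lam (x m)| - 0))).
  under eq_fun do rewrite subr0 xn.
  apply: cvg0_nearP => [k|e e0]; first exact: nrm_ge0.
  have [K _ hK] := near_infty_natSinv_lt (PosNum e0).
  exists K => // k /= Kk.
  have [_ _ _ h _] := fP (l k); rewrite size_l in h.
  by rewrite /nrm normr_id; exact: lt_trans h (hK _ Kk).
Qed.
End WeakSequences.

(** * Unbounded operators and their adjoints *)

Section Operators.
Context {R : realType} {H0 : completeNormedModType (C R)}
  {dot : {dot H0 for conjC}}.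
Context (dot_norm : forall x : H0, `|x| ^+ 2 = dot x x).
Implicit Types (W : set H0) (A S : operator H0).

Definition linear_operator A :=
  linear_subspace (dom A) /\ forall (a : C R) (x y : H0),
    dom A x -> dom A y -> A (a *: x + y) = a *: A x + A y.

Lemma linop0 A : linear_operator A -> A 0 = 0.
Proof.
move=> [[A0 _] lin]; have := lin (-1) 0 0 A0 A0.
by rewrite scaler0 addr0 scaleN1r addNr.
Qed.

Lemma linopZ A a x : linear_operator A -> dom A x -> A (a *: x) = a *: A x.
Proof.
move=> lA Ax; have [[A0 _] lin] := lA.
by have := lin a x 0 Ax A0; rewrite addr0 linop0// addr0.
Qed.

Lemma linopD A x y : linear_operator A -> dom A x -> dom A y ->
  A (x + y) = A x + A y.
Proof. by move=> [_ lin] Ax Ay; have := lin 1 x y Ax Ay; rewrite !scale1r. Qed.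

Lemma linopB A x y : linear_operator A -> dom A x -> dom A y ->
  A (x - y) = A x - A y.
Proof.
move=> lA Ax Ay; have [sA _] := lA.
have Ay1 : dom A (-1 *: y) by exact: subspaceZ.
by rewrite -(scaleN1r y) (linopD lA Ax Ay1) (linopZ _ lA Ay) !scaleN1r.
Qed.

Lemma nrm_invZ (x : H0) : x != 0 -> nrm (((nrm x)^-1%:C)%C *: x) = 1.
Proof.
move=> /nrm_gt0/lt0r_neq0 nx.
by rewrite nrmZ nrm_real ger0_norm ?invr_ge0 ?nrm_ge0// mulVf.
Qed.

Lemma opnorm_le_bound A (K : R) : linear_operator A -> (opnorm A <= K%:E)%E ->
  forall x, dom A x -> nrm (A x) <= K * nrm x.
Proof.
move=> lA AK x Ax; have [->|x0] := eqVneq x 0.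
  by rewrite linop0// !nrm0 mulr0.
have nx := nrm_gt0 x0.
have [sA _] := lA; set y := (((nrm x)^-1%:C)%C : C R) *: x.
have : (((nrm (A y))%:E <= K%:E)%E).
  apply: le_trans AK; apply: ereal_sup_ubound; exists y => //=.
  by split; [exact: subspaceZ|rewrite nrmE nrm_invZ].
rewrite lee_fin linopZ// nrmZ nrm_real ger0_norm ?invr_ge0 ?nrm_ge0//.
by rewrite mulrC ler_pdivrMr.
Qed.

Lemma opnorm_bounded A : linear_operator A -> (opnorm A < +oo)%E ->
  exists2 K : R, 0 <= K & forall x, dom A x -> nrm (A x) <= K * nrm x.
Proof.
move=> lA Aoo; have [K K0 AK] : exists2 K : R, 0 <= K & (opnorm A <= K%:E)%E.
  case: (opnorm A) Aoo => [r _|//|_].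
    by exists (Num.max 0 r); rewrite ?lee_fin le_max lexx ?orbT.
  by exists 0; rewrite // leNye.
by exists K => //; exact: opnorm_le_bound.
Qed.

Lemma bounded_opnorm A (K : R) : 0 <= K ->
  (forall x, dom A x -> nrm (A x) <= K * nrm x) -> (opnorm A < +oo)%E.
Proof.
move=> K0 AK; apply: (@le_lt_trans _ _ K%:E); last exact: ltry.
apply: ge_ereal_sup => _ [x [Ax x1] <-]; rewrite lee_fin.
apply: le_trans (AK _ Ax) _; rewrite -[leRHS]mulr1 ler_wpM2l//.
by move: x1; rewrite nrmE -(lec_real (nrm x) 1).
Qed.

Lemma inverse_linear A : linear_operator A -> {in dom A &, injective A} ->
  linear_operator (inverse A).
Proof.
move=> lA iA; have [[A0 sA] lin] := lA.
have invK x : dom A x -> inverse A (A x) = x.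
  by move=> Ax; apply: pinvKV iA _ _; rewrite inE.
split; first split.
- by exists 0; rewrite ?linop0.
- move=> a _ _ [x Ax <-] [y Ay <-]; exists (a *: x + y); first exact: sA.
  exact: lin.
- by move=> a _ _ [x Ax <-] [y Ay <-]; rewrite -lin// !invK//; exact: sA.
Qed.

(** Surjectivity and a lower bound are easier to perturb than the inverse
    itself. *)
Lemma boundedly_invertibleP W A : linear_operator A ->
  boundedly_invertible W A <->
  [/\ forall x, dom A x -> W (A x),
      forall y, W y -> exists2 x, dom A x & A x = y &
      exists2 K : R, 0 <= K & forall x, dom A x -> nrm x <= K * nrm (A x)].
Proof.
move=> lA; have [sA _] := lA.
have invK : {in dom A &, injective A} ->
    forall x, dom A x -> inverse A (A x) = x.
  by move=> /pinvKV h x Ax; apply: h; rewrite inE.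
split=> [[[fA iA sAW] Ainv]|[fA sAW [K K0 AK]]].
- split; [exact: fA|by move=> y /sAW[x Ax <-]; exists x|].
  have [K K0 invA] := opnorm_bounded (inverse_linear lA iA) Ainv.
  exists K => // x Ax; have := invA (A x); rewrite invK//; apply.
  by exists x.
- have iA : {in dom A &, injective A}.
    move=> x y; rewrite !inE => Ax Ay Axy; apply/subr0_eq/nrm_eq0/eqP.
    rewrite eq_le nrm_ge0 andbT; apply: le_trans (AK _ (subspaceB sA Ax Ay)) _.
    by rewrite linopB// Axy subrr nrm0 mulr0.
  split; first by split=> // y /sAW[x Ax <-]; exists x.
  apply: (bounded_opnorm K0) => _ [x Ax <-]; rewrite invK//; exact: AK.
Qed.

Lemma inverse_in W A y : boundedly_invertible W A -> W y -> dom A (inverse A y).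
Proof.
move=> [[_ iA sA] _] /sA[x Ax <-].
by have -> : inverse A (A x) = x by apply: pinvKV iA _ _; rewrite inE.
Qed.

Lemma inverseK W A y : boundedly_invertible W A -> W y -> A (inverse A y) = y.
Proof.
move=> [[_ iA sA] _] /sA[x Ax <-].
by have -> : inverse A (A x) = x by apply: pinvKV iA _ _; rewrite inE.
Qed.

Lemma inverseVK W A x : boundedly_invertible W A -> dom A x ->
  inverse A (A x) = x.
Proof. by move=> [[_ iA sA] _] Ax; apply: pinvKV iA _ _; rewrite inE. Qed.

Lemma dom_inverse W A : boundedly_invertible W A -> dom (inverse A) = W.
Proof.
move=> [[fA _ sA] _]; apply/seteqP; split=> [_ [x Ax <-]|y /sA//]; exact: fA.
Qed.

Lemma dense_separates W D z : D `<=` W -> W `<=` closure D -> W z ->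
  (forall x, D x -> dot x z = 0) -> z = 0.
Proof.
move=> DW WD Wz Dz; apply: nrm_eq0; apply/eqP; rewrite eq_le nrm_ge0 andbT.
apply/ler_addgt0Pr => e e0; rewrite add0r.
have e0' : (0 : C R) < (e%:C)%C by rewrite (ltc_real 0).
have [x [Dx]] := WD z Wz _ (nbhsx_ballx z _ e0').
rewrite -ball_normE /= nrmE ltc_real => /ltW zx.
have [->|z0] := eqVneq z 0; first by rewrite nrm0 ltW.
have nz := nrm_gt0 z0.
rewrite -(ler_pM2r nz); apply: (@le_trans _ _ (nrm (dot (z - x) z))).
  by rewrite dotBl (Dz x Dx) subr0 dot_nrm// nrm_real expr2 ger0_norm// mulr_ge0 ?nrm_ge0.
by apply: le_trans (nrm_dot_le dot_norm _ _) _; rewrite ler_wpM2r ?nrm_ge0.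
Qed.

Lemma adjoint_rel_unique W A y z z' : linear_subspace W -> dom A `<=` W ->
  W `<=` closure (dom A) -> adjoint_rel dot W A y z -> adjoint_rel dot W A y z' ->
  z = z'.
Proof.
move=> sW AW WA [_ Wz hz] [_ Wz' hz']; apply/subr0_eq.
apply: (dense_separates AW WA); first exact: subspaceB.
by move=> x Ax; rewrite dotBr -hz// -hz'// subrr.
Qed.

Lemma adjointE W A y z : linear_subspace W -> dom A `<=` W ->
  W `<=` closure (dom A) -> adjoint_rel dot W A y z -> adjoint dot W A y = z.
Proof.
move=> sW AW WA hz; apply: (adjoint_rel_unique sW AW WA) (hz).
by rewrite /adjoint /=; apply: (@xgetPex _ 0 [set z | adjoint_rel dot W A y z]); exists z.
Qed.

Lemma adjointP W A y : dom (adjoint dot W A) y ->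
  adjoint_rel dot W A y (adjoint dot W A y).
Proof.
move=> [z hz].
by rewrite /adjoint /=; apply: (@xgetPex _ 0 [set z | adjoint_rel dot W A y z]); exists z.
Qed.

Lemma adjoint_linear W A : linear_subspace W -> dom A `<=` W ->
  W `<=` closure (dom A) -> linear_operator (adjoint dot W A).
Proof.
move=> sW AW WA.
have comb a y y' z z' : adjoint_rel dot W A y z -> adjoint_rel dot W A y' z' ->
    adjoint_rel dot W A (a *: y + y') (a *: z + z').
  move=> [Wy Wz hz] [Wy' Wz' hz']; case: sW => _ sW.
  split; [exact: sW|exact: sW|move=> x Ax].
  by rewrite !dotDr !dotZr hz// hz'.
split; first split.
- exists 0; split; [by case: sW|by case: sW|by move=> x _; rewrite !linear0r].
- by move=> a y y' [z hz] [z' hz']; exists (a *: z + z'); exact: comb.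
- move=> a y y' /adjointP hy /adjointP hy'.
  by apply: adjointE => //; exact: comb.
Qed.

(** The adjoint vector [z] exists by [riesz], and its norm is controlled by
    [|z|^2 = <A z, y>]. *)
Lemma bounded_adjoint W A (K : R) y : linear_operator A -> dom A = W ->
  seq_closed W -> (forall x, W x -> nrm (A x) <= K * nrm x) -> W y ->
  adjoint_rel dot W A y (adjoint dot W A y) /\
  nrm (adjoint dot W A y) <= K * nrm y.
Proof.
move=> [sA lin] AW cW AK Wy; rewrite AW in sA lin.
have rel : adjoint_rel dot W A y (adjoint dot W A y).
  apply: adjointP.
  have [||z Wz hz] := @riesz _ _ dot dot_norm W (fun x => dot (A x) y)
    (K * nrm y) sA cW.
  - by move=> a x x' Wx Wx'; rewrite lin// dotDl dotZl.
  - move=> x Wx; apply: le_trans (nrm_dot_le dot_norm _ _) _.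
    by rewrite mulrAC ler_wpM2r ?nrm_ge0 ?AK.
  - by exists z; split => // x; rewrite AW; exact: hz.
split => //; set z := adjoint dot W A y in rel *.
have [_ Wz hz] := rel.
have [z0|z0] := eqVneq z 0.
  have := AK y Wy; rewrite z0 nrm0; apply: le_trans; exact: nrm_ge0.
have nz := nrm_gt0 z0.
rewrite -(ler_pM2r nz); apply: (@le_trans _ _ (nrm (dot (A z) y))).
  rewrite hz ?AW// dot_nrm// nrm_real expr2 ger0_norm// mulr_ge0 ?nrm_ge0//.
apply: le_trans (nrm_dot_le dot_norm _ _) _.
by rewrite mulrAC ler_wpM2r ?nrm_ge0 ?AK.
Qed.

Lemma adjoint_inverse_rel W A y : linear_operator A -> linear_subspace W ->
  seq_closed W -> boundedly_invertible W A -> W y ->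
  adjoint_rel dot W (inverse A) y (adjoint dot W (inverse A) y).
Proof.
move=> lA sW cW Ainv Wy; have [[_ iA _] _] := Ainv; have lI := inverse_linear lA iA.
have dI := dom_inverse Ainv; have [K _ IK] := opnorm_bounded lI (proj2 Ainv).
rewrite dI in IK; by have [] := bounded_adjoint lI dI cW IK Wy.
Qed.

End Operators.

(** * Pencils with bounded higher coefficients *)

Section Pencils.
Context {R : realType} {H0 : completeNormedModType (C R)}.
Implicit Types (W : set H0) (M : nat).

Record bounded_pencil W M (A : 'I_M.+1 -> operator H0) (K : R) : Prop := {
  bp_sub : linear_subspace W;
  bp_closed : seq_closed W;
  bp_lin : forall j, linear_operator (A j);
  bp_dom : forall j, j != ord0 -> dom (A j) = W;
  bp_dom0 : dom (A ord0) `<=` W;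
  bp_dense : W `<=` closure (dom (A ord0));
  bp_in : forall j x, dom (A j) x -> W (A j x);
  bp_ge0 : 0 <= K;
  bp_bound : forall j x, j != ord0 -> W x -> nrm (A j x) <= K * nrm x }.

(** Differences of values of a pencil have this form ([pencilB]): the unbounded
    coefficient cancels. *)
Definition perturbation M (A : 'I_M.+1 -> operator H0) (c : 'I_M.+1 -> C R)
    (x : H0) : H0 := \sum_(j < M.+1 | j != ord0) c j *: A j x.

Lemma pencilB M (A : 'I_M.+1 -> operator H0) lam mu x :
  pencil A lam x - pencil A mu x = perturbation A (fun j => lam ^+ j - mu ^+ j) x.
Proof.
rewrite /= -sumrB (bigD1 ord0)//= !expr0 subrr add0r.
by apply: eq_bigr => j _; rewrite scalerBl.
Qed.

Lemma perturbation_linear W M (A : 'I_M.+1 -> operator H0) K c a x y :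
  bounded_pencil W A K -> W x -> W y ->
  perturbation A c (a *: x + y) = a *: perturbation A c x + perturbation A c y.
Proof.
move=> bA Wx Wy; rewrite /perturbation scaler_sumr -big_split /=.
apply: eq_bigr => j j0; have [_ lin] := bp_lin bA j.
by rewrite lin ?(bp_dom bA j0)// scalerDr !scalerA mulrC.
Qed.

Lemma perturbationD W M (A : 'I_M.+1 -> operator H0) K c x y :
  bounded_pencil W A K -> W x -> W y ->
  perturbation A c (x + y) = perturbation A c x + perturbation A c y.
Proof.
by move=> bA Wx Wy; rewrite -[x]scale1r (perturbation_linear c 1 bA)// !scale1r.
Qed.

Lemma perturbationB W M (A : 'I_M.+1 -> operator H0) K c x y :
  bounded_pencil W A K -> W x -> W y ->
  perturbation A c (x - y) = perturbation A c x - perturbation A c y.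
Proof.
move=> bA Wx Wy; rewrite -[x - y]addrC -(scaleN1r y).
by rewrite (perturbation_linear c (-1) bA)// scaleN1r addrC.
Qed.

Lemma perturbationZ W M (A : 'I_M.+1 -> operator H0) K c a x :
  bounded_pencil W A K -> W x ->
  perturbation A c (a *: x) = a *: perturbation A c x.
Proof.
move=> bA Wx; rewrite /perturbation scaler_sumr; apply: eq_bigr => j j0.
by rewrite (linopZ _ (bp_lin bA j)) ?(bp_dom bA j0)// !scalerA mulrC.
Qed.

Lemma subspace_sum W (I : Type) (r : seq I) (Q : pred I) (F : I -> H0) :
  linear_subspace W -> (forall i, Q i -> W (F i)) ->
  W (\sum_(i <- r | Q i) F i).
Proof.
move=> sW WF; elim/big_ind : _ => //; first by case: sW.
by move=> x y; exact: subspaceD.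
Qed.

Lemma perturbation_in W M (A : 'I_M.+1 -> operator H0) K c x :
  bounded_pencil W A K -> W x -> W (perturbation A c x).
Proof.
move=> bA Wx; apply: subspace_sum; first exact: bp_sub bA.
move=> j j0; apply: subspaceZ; first exact: bp_sub bA.
by apply: (bp_in bA); rewrite (bp_dom bA j0).
Qed.

Lemma perturbation_bound W M (A : 'I_M.+1 -> operator H0) K c x :
  bounded_pencil W A K -> W x ->
  nrm (perturbation A c x) <=
    (\sum_(j < M.+1 | j != ord0) nrm (c j)) * K * nrm x.
Proof.
move=> bA Wx; apply: le_trans (nrm_sum _ _ _) _.
rewrite -mulrA mulr_suml; apply: ler_sum => j j0.
by rewrite nrmZ ler_wpM2l ?nrm_ge0//; exact: (bp_bound bA).
Qed.

Lemma pencil_linear W M (A : 'I_M.+1 -> operator H0) K lam :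
  bounded_pencil W A K -> linear_operator (pencil A lam).
Proof.
move=> bA; have [s0 _] := bp_lin bA ord0; split=> // a x y Ax Ay.
rewrite /= scaler_sumr -big_split /=; apply: eq_bigr => j _.
have [_ lin] := bp_lin bA j.
have dj z : dom (A ord0) z -> dom (A j) z.
  by have [->//|j0] := eqVneq j ord0; rewrite (bp_dom bA j0); exact: bp_dom0 bA _.
by rewrite lin; [|exact: dj..]; rewrite scalerDr !scalerA mulrC.
Qed.

Lemma pencil_in W M (A : 'I_M.+1 -> operator H0) K lam x :
  bounded_pencil W A K -> dom (A ord0) x -> W (pencil A lam x).
Proof.
move=> bA Ax; apply: subspace_sum; first exact: bp_sub bA.
move=> j _; apply: subspaceZ; first exact: bp_sub bA.
apply: (bp_in bA); have [->//|j0] := eqVneq j ord0.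
by rewrite (bp_dom bA j0); exact: bp_dom0 bA _ Ax.
Qed.

(** A second-order Taylor expansion is what the discrete maximum principle below
    needs: averaging over four directions removes the terms of order one and two. *)
Lemma monomial_jet (mu : C R) (j : nat) : exists b1 b2 (q : C R -> C R) (k : R),
  forall h, (mu + h) ^+ j - mu ^+ j = h * b1 + h ^+ 2 * b2 + h ^+ 3 * q h /\
    (nrm h <= 1 -> nrm (q h) <= k).
Proof.
elim: j => [|j [b1 [b2 [q [k jet]]]]].
  exists 0, 0, (fun=> 0), 0 => h; split; first by rewrite !expr0 subrr !mulr0 !addr0.
  by rewrite nrm0.
exists (mu * b1 + mu ^+ j), (mu * b2 + b1), (fun h => b2 + (mu + h) * q h),
  (nrm b2 + (nrm mu + 1) * k) => h.
have [eq1 bd] := jet h; split.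
  have eq2 : (mu + h) ^+ j = mu ^+ j + (h * b1 + h ^+ 2 * b2 + h ^+ 3 * q h).
    by rewrite -eq1 [RHS]addrC subrK.
  by rewrite !exprS eq2; ring.
move=> h1; apply: le_trans (nrmD _ _) _; rewrite lerD2l nrmM.
apply: ler_pM; rewrite ?nrm_ge0//; last exact: bd.
by apply: le_trans (nrmD _ _) _; rewrite lerD2l.
Qed.

(** The coefficients of the expansion depend on [mu] alone, hence serve all
    pencils of degree [M] at once. *)
Lemma pencil_jet M (mu : C R) : exists b1 b2 (q : C R -> 'I_M.+1 -> C R) (k : R),
  0 <= k /\ forall W (A : 'I_M.+1 -> operator H0) K, bounded_pencil W A K ->
  forall h x, pencil A (mu + h) x - pencil A mu x =
    h *: perturbation A b1 x + h ^+ 2 *: perturbation A b2 x +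
    h ^+ 3 *: perturbation A (q h) x /\
    (nrm h <= 1 -> W x -> nrm (perturbation A (q h) x) <= k * K * nrm x).
Proof.
have /choice[b1 /choice[b2 /choice[q /choice[k jet]]]] :=
  fun j : 'I_M.+1 => monomial_jet mu j.
exists b1, b2, (fun h j => q j h), (\sum_(j < M.+1 | j != ord0) k j).
have k0 j : 0 <= k j.
  have [_ /(_ _)] := jet j 0; rewrite nrm0 => /(_ ler01).
  by apply: le_trans; exact: nrm_ge0.
split; first by apply: sumr_ge0 => j _.
move=> W A K bA h x; split.
  rewrite pencilB /perturbation !scaler_sumr -!big_split /=.
  apply: eq_bigr => j _; rewrite (proj1 (jet j h)).
  by rewrite !scalerDl !scalerA.
move=> h1 Wx; apply: le_trans (perturbation_bound _ bA Wx) _.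
rewrite ler_wpM2r ?nrm_ge0// ler_wpM2r ?(bp_ge0 bA)//.
by apply: ler_sum => j _; exact: (proj2 (jet j h)).
Qed.

(** The constant is common to all pencils with the same coefficient bound. *)
Lemma pencil_lipschitz M (mu : C R) (K : R) : 0 <= K ->
  exists2 L : R, 0 < L & forall W (A : 'I_M.+1 -> operator H0), bounded_pencil W A K ->
  forall lam x, nrm (lam - mu) <= 1 -> W x ->
    nrm (pencil A lam x - pencil A mu x) <= L * nrm (lam - mu) * nrm x.
Proof.
move=> K0; have [b1 [b2 [q [k [k0 jet]]]]] := pencil_jet M mu.
pose s (b : 'I_M.+1 -> C R) : R := (\sum_(j < M.+1 | j != ord0) nrm (b j)) * K.
have s0 b : 0 <= s b by rewrite mulr_ge0// sumr_ge0// => j _; exact: nrm_ge0.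
exists (s b1 + s b2 + k * K + 1).
  by rewrite ltr_wpDl// !addr_ge0// mulr_ge0.
move=> W A bA lam x h1 Wx; set h := lam - mu in h1 *.
have -> : lam = mu + h by rewrite /h addrC subrK.
have [-> /(_ h1 Wx) bq] := jet W A K bA h x.
have c1 := perturbation_bound b1 bA Wx; have c2 := perturbation_bound b2 bA Wx.
rewrite -/(s b1) in c1; rewrite -/(s b2) in c2.
have hh n : nrm (h ^+ n.+1) <= nrm h.
  elim: n => // n IH; rewrite exprS nrmM; apply: le_trans IH.
  by rewrite -[leRHS]mul1r ler_wpM2r ?nrm_ge0.
have step n (y : H0) (a : R) : nrm y <= a * nrm x ->
    nrm (h ^+ n.+1 *: y) <= nrm h * (a * nrm x).
  by move=> ya; rewrite nrmZ; apply: ler_pM; rewrite ?nrm_ge0.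
have t1 := step 0%N _ _ c1; have t2 := step 1%N _ _ c2; have t3 := step 2%N _ _ bq.
rewrite expr1 in t1.
apply: le_trans (nrmD _ _) _; apply: le_trans (lerD (nrmD _ _) (lexx _)) _.
have : 0 <= nrm h * nrm x by rewrite mulr_ge0 ?nrm_ge0.
lra.
Qed.

End Pencils.

(** * Stability of bounded invertibility *)

Section Stability.
Context {R : realType} {H0 : completeNormedModType (C R)}
  {dot : {dot H0 for conjC}}.
Context (dot_norm : forall x : H0, `|x| ^+ 2 = dot x x).
Implicit Types (W : set H0) (M : nat).

(** If [T lam x_n] converges, so does [x_n] by the lower bound, and [T lam] is a
    closed operator because it is a bounded perturbation of the invertible operator
    [T lam0]. *)
Lemma closed_range W M (A : 'I_M.+1 -> operator H0) K lam0 lam (k : R) :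
  bounded_pencil W A K -> boundedly_invertible W (pencil A lam0) ->
  (forall x, dom (A ord0) x -> nrm x <= k * nrm (pencil A lam x)) ->
  seq_closed (pencil A lam @` dom (A ord0)).
Proof.
move=> bA inv0 low u v Su uv.
have lT mu := pencil_linear mu bA; have sD := (proj1 (bp_lin bA ord0)).
have /choice[x xP] : forall n, exists x, dom (A ord0) x /\ pencil A lam x = u n.
  by move=> n; have [x] := Su n; exists x.
have uv0 : nrm (u n - v) @[n --> \oo] --> (0 : R) by exact/cvg_nrmP.
have [y xy] : exists y : H0, x @ \oo --> y.
  apply: cauchy_nrm_cvg => e e0.
  have k1 : 0 < `|k| + 1 by rewrite ltr_wpDl.
  have e2 : 0 < e / 2 / (`|k| + 1) by rewrite !divr_gt0.
  have [N _ hN] := cvg0_near e2 uv0; exists N => n Nn.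
  have [xN uN] := xP N; have [xn un] := xP n.
  have := low _ (subspaceB sD xN xn); rewrite (linopB (lT lam) xN xn) uN un => h.
  have hN1 := hN N (leqnn N); have hn1 := hN n Nn.
  have tri : nrm (u N - u n) < e / (`|k| + 1).
    have -> : u N - u n = (u N - v) - (u n - v) by rewrite opprB addrA subrK.
    apply: le_lt_trans (nrmB _ _) _; rewrite /= in hN1 hn1.
    have -> : e / (`|k| + 1) = e / 2 / (`|k| + 1) + e / 2 / (`|k| + 1).
      by field; rewrite gt_eqF.
    exact: ltrD.
  apply: le_lt_trans h _; move: tri; rewrite ltr_pdivlMr// mulrC => tri.
  apply: le_lt_trans tri; apply: ler_wpM2r; first exact: nrm_ge0.
  by apply: (le_trans (ler_norm k)); rewrite lerDl.
have Wu n : W (u n) by have [xn <-] := xP n; exact: pencil_in bA xn.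
have Wx n : W (x n) by apply: (bp_dom0 bA); case: (xP n).
have Wv : W v by exact: bp_closed bA _ _ Wu uv.
have Wy : W y by exact: bp_closed bA _ _ Wx xy.
pose c (j : 'I_M.+1) : C R := lam0 ^+ j - lam ^+ j.
have Wf : W (v + perturbation A c y).
  by apply: (subspaceD (bp_sub bA) Wv); exact: (perturbation_in _ bA Wy).
pose y' := inverse (pencil A lam0) (v + perturbation A c y).
have Dy' : dom (A ord0) y' by exact: (inverse_in inv0 Wf).
have Ty' : pencil A lam0 y' = v + perturbation A c y by exact: (inverseK inv0 Wf).
have [_ _ [k0 k00 low0]] := (boundedly_invertibleP W (lT lam0)).1 inv0.
suff yy' : y = y'.
  exists y' => //; have /eqP := pencilB A lam0 lam y'.
  by rewrite Ty' -yy' subr_eq [X in X == _]addrC => /eqP/addrI ->.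
apply/subr0_eq/nrm_eq0/eqP; rewrite eq_le nrm_ge0 andbT.
set s := (\sum_(j < M.+1 | j != ord0) nrm (c j)) * K.
have lim : nrm (x n - y) + (k0 * nrm (u n - v) + (k0 * s) * nrm (x n - y))
    @[n --> \oo] --> (0 : R).
  by apply: cvg0D; [exact/cvg_nrmP|apply: cvg0D; apply: cvg0Ml => //; exact/cvg_nrmP].
apply: (cvgr_to_ge lim); apply: nearW => n.
have [xn un] := xP n.
have -> : y - y' = (x n - y') - (x n - y) by rewrite opprB [RHS]addrC addrA subrK.
apply: le_trans (nrmB _ _) _; rewrite addrC lerD2l.
apply: le_trans (low0 _ (subspaceB sD xn Dy')) _.
rewrite -mulrA -mulrDr ler_wpM2l//.
rewrite (linopB (lT lam0) xn Dy') Ty'.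
have -> : pencil A lam0 (x n) = u n + perturbation A c (x n).
  by rewrite -un -pencilB addrC subrK.
have -> : u n + perturbation A c (x n) - (v + perturbation A c y) =
    (u n - v) + perturbation A c (x n - y).
  by rewrite (perturbationB c bA)// opprD addrACA.
apply: le_trans (nrmD _ _) _; rewrite lerD2l.
apply: (perturbation_bound _ bA); exact: (subspaceB (bp_sub bA) (Wx n) Wy).
Qed.

(** A vector orthogonal to the range of [T lam] lies in the domain of the adjoint
    of [T mu], which maps it to a vector of much smaller norm; the lower bound for
    the adjoint makes it zero.  Hence the range, being closed, is everything. *)
Lemma boundedly_invertible_near W M (A : 'I_M.+1 -> operator H0) K lam0 mu lam (e : R) :
  bounded_pencil W A K -> boundedly_invertible W (pencil A lam0) -> 0 < e ->
  (forall x, dom (A ord0) x -> e * nrm x <= nrm (pencil A mu x)) ->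
  (forall y, dom (adjoint dot W (pencil A mu)) y ->
     e * nrm y <= nrm (adjoint dot W (pencil A mu) y)) ->
  (forall x, W x -> nrm (pencil A lam x - pencil A mu x) <= e / 2 * nrm x) ->
  boundedly_invertible W (pencil A lam).
Proof.
move=> bA inv0 e0 low lowadj close.
have lT nu := pencil_linear nu bA.
have e2 : 0 < e / 2 by rewrite divr_gt0.
have low2 x : dom (A ord0) x -> nrm x <= (e / 2)^-1 * nrm (pencil A lam x).
  move=> Ax; rewrite ler_pdivlMl//.
  have h1 := low x Ax; have h2 := close x (bp_dom0 bA Ax).
  have := nrmB (pencil A lam x) (pencil A lam x - pencil A mu x).
  rewrite subKr; lra.
apply/(boundedly_invertibleP W (lT lam)); split.
- by move=> x Ax; exact: pencil_in bA Ax.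
- move=> v Wv.
  have sR : linear_subspace (pencil A lam @` dom (A ord0)).
    have [sD _] := bp_lin bA ord0; split.
      by exists 0; [case: sD|exact: linop0 (lT lam)].
    move=> a _ _ [x Ax <-] [y Ay <-]; exists (a *: x + y).
      by case: sD => _; apply.
    by have [_ lin] := lT lam; exact: lin.
  have [_ [x Ax <-] ort] :=
    projection_theorem dot_norm v sR (closed_range bA inv0 low2).
  exists x => //; apply/esym/subr0_eq; set y := v - _ in ort *.
  have Wy : W y by apply: (subspaceB (bp_sub bA) Wv); exact: (pencil_in _ bA Ax).
  pose c (j : 'I_M.+1) : C R := mu ^+ j - lam ^+ j.
  have bd z : W z -> nrm (perturbation A c z) <= e / 2 * nrm z.
    by move=> Wz; rewrite -pencilB nrm_distC; exact: close.
  pose D := Operator W (perturbation A c).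
  have lD : linear_operator D.
    by split; [exact: bp_sub bA|move=> a z z' Wz Wz'; exact: perturbation_linear bA Wz Wz'].
  have [[_ Wz hz] zy] := bounded_adjoint dot_norm lD erefl (bp_closed bA) bd Wy.
  set z := adjoint dot W D y in Wz hz zy.
  have rel : adjoint_rel dot W (pencil A mu) y z.
    split=> // x' Ax'; rewrite -hz; last exact: bp_dom0 bA _ Ax'.
    have -> : pencil A mu x' = pencil A lam x' + perturbation A c x'.
      by rewrite -pencilB addrC subrK.
    by rewrite dotDl (dotC y) ort ?conjC0 ?add0r//; exists x'.
  have := lowadj y (ex_intro _ z rel).
  rewrite (adjointE (A := pencil A mu) dot_norm (bp_sub bA) (bp_dom0 bA) (bp_dense bA) rel) => h.
  apply: nrm_eq0; apply/eqP; rewrite eq_le nrm_ge0 andbT.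
  have : e / 2 * nrm y <= 0 by lra.
  by rewrite pmulr_rle0.
- by exists (e / 2)^-1; rewrite ?invr_ge0 1?ltW.
Qed.

End Stability.

(** * Weak control of approximate kernels *)

Section WeakControl.
Context {R : realType} {H0 : completeNormedModType (C R)}
  {dot : {dot H0 for conjC}}.
Context (dot_norm : forall x : H0, `|x| ^+ 2 = dot x x).
Implicit Types (S : nat -> operator H0).

(** Quantitatively: bounded sequences on which the [S n] tend to zero converge
    weakly to zero. *)
Definition weakly_controlled S := forall z : H0, exists (B : R) (e : nat -> R),
  [/\ 0 <= B, e n @[n --> \oo] --> (0 : R) & \forall n \near \oo, forall x,
     dom (S n) x -> nrm (dot x z) <= B * nrm (S n x) + e n * nrm x].

Lemma proj_id (W : set H0) P x : linear_subspace W ->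
  orthogonal_projection dot W P -> W x -> P x = x.
Proof.
move=> sW hP Wx; have [WPx ort] := hP x; apply/esym/subr0_eq/eqP.
by rewrite -(dnorm_eq0 dot) ort//; exact: subspaceB.
Qed.

Lemma dot_proj_r (W : set H0) P x z : linear_subspace W ->
  orthogonal_projection dot W P -> W x -> dot x (P z) = dot x z.
Proof.
move=> sW hP Wx; have [_ /(_ _ Wx) ort] := hP z.
apply/esym/subr0_eq; rewrite -dotBr (dotC (z - P z)) ort; exact: conjC0.
Qed.

(** If [zn n] is the image of [wn n] under the adjoint of [S n], then
    [<x, zn n> = <S n x, wn n>] is small with [S n x]; vectors outside [H] are
    handled by the convergence of the projections. *)
Lemma weak_control (H : set H0) (Hn : nat -> set H0) (P : H0 -> H0)
    (Pn : nat -> H0 -> H0) S :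
  (forall n, linear_subspace (Hn n)) ->
  orthogonal_projection dot H P ->
  (forall n, orthogonal_projection dot (Hn n) (Pn n)) -> strong_cvg Pn P ->
  (forall n, dom (S n) `<=` Hn n) ->
  (forall z, H z -> exists (w : H0) (wn zn : nat -> H0),
     [/\ wn @ \oo --> w, zn @ \oo --> z &
         forall n x, dom (S n) x -> dot (S n x) (wn n) = dot x (zn n)]) ->
  weakly_controlled S.
Proof.
move=> Hn_sub P_proj Pn_proj PnP domS approx z.
have [w [wn [zn [ww zz rel]]]] := approx (P z) (proj1 (P_proj z)).
exists (nrm w + 1), (fun n => nrm (Pn n z - P z) + nrm (zn n - P z)); split.
- by rewrite addr_ge0 ?nrm_ge0.
- by apply: cvg0D; apply/cvg_nrmP => //; exact: PnP.
- have near1 : \forall n \near \oo, nrm (wn n - w) < 1.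
    by apply: cvg0_near => //; exact/cvg_nrmP.
  apply: filterS near1 => n wn1 x Sx.
  rewrite -(dot_proj_r z (Hn_sub n) (Pn_proj n) (domS n x Sx)).
  have -> : dot x (Pn n z) = dot (S n x) (wn n) + (dot x (Pn n z - P z) -
     dot x (zn n - P z)) by rewrite rel// !dotBr; ring.
  apply: le_trans (nrmD _ _) _; apply: lerD.
    apply: le_trans (nrm_dot_le dot_norm _ _) _.
    rewrite mulrC ler_wpM2r ?nrm_ge0//.
    have := nrmD w (wn n - w); rewrite addrCA subrr addr0; lra.
  apply: le_trans (nrmB _ _) _; rewrite mulrDl; apply: lerD;
  by apply: le_trans (nrm_dot_le dot_norm _ _) _; rewrite mulrC.
Qed.

(** Under weak control approximate kernel vectors converge weakly to zero, so
    outside the limiting essential spectrum there are none. *)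
Lemma weakly_controlled_lower_bound S :
  (forall n, linear_operator (S n)) -> weakly_controlled S ->
  ~ approximately_singular (dot := dot) S ->
  exists2 d : R, 0 < d & \forall n \near \oo, forall x, dom (S n) x ->
    d * nrm x <= nrm (S n x).
Proof.
move=> linS wc; move=> /existsNP[e /existsNP[F /existsNP[N /not_implyP[e0 nex]]]].
have [B [B0 hB]] : exists B : R, 0 <= B /\ \forall n \near \oo, forall x f,
    f \in F -> dom (S n) x -> nrm x = 1 -> nrm (dot x f) <= B * nrm (S n x) + e / 2.
  elim: F {nex} => [|f F [B [B0 hB]]]; first by exists 0; split=> //; apply: nearW.
  have [B1 [e1 [B10 e1lim h1]]] := wc f.
  exists (B + B1); split; first exact: addr_ge0.
  have e2 : 0 < e / 2 by rewrite divr_gt0.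
  have h2 : \forall n \near \oo, e1 n < e / 2 by exact: cvg0_near.
  apply: filterS3 hB h1 h2 => n hB h1 h2 x g.
  have BS := mulr_ge0 B0 (nrm_ge0 (S n x)); have B1S := mulr_ge0 B10 (nrm_ge0 (S n x)).
  rewrite inE => /orP[/eqP ->|gF] Sx x1; last by have := hB x g gF Sx x1; lra.
  by have := h1 x Sx; rewrite x1; lra.
(* With [B * d < e / 2] the bound [hB] makes all pairings smaller than [e]. *)
pose d := Num.min e (e / 2 / (B + 1)).
have B1 : 0 < B + 1 by rewrite ltr_wpDl.
have d0 : 0 < d by rewrite lt_min e0 !divr_gt0.
exists d => //; have hN : \forall n \near \oo, (N <= n)%N by exists N.
apply: filterS2 hB hN => n hB Nn x Sx.
have [->|x0] := eqVneq x 0; first by rewrite nrm0 mulr0 nrm_ge0.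
have nx := nrm_gt0 x0; rewrite leNgt; apply/negP => small.
pose y := (((nrm x)^-1%:C)%C : C R) *: x.
have Sy : dom (S n) y by apply: subspaceZ Sx; case: (linS n).
have y1 : nrm y = 1 by exact: nrm_invZ.
have Sy_lt : nrm (S n y) < d.
  rewrite (linopZ _ (linS n) Sx) nrmZ nrm_real ger0_norm ?invr_ge0 ?nrm_ge0//.
  by rewrite mulrC ltr_pdivrMr.
apply: nex; exists n, y; split=> //.
  by apply: lt_le_trans Sy_lt _; rewrite ge_min lexx.
move=> f fF; apply: le_lt_trans (hB y f fF Sy y1) _.
have : nrm (S n y) < e / 2 / (B + 1).
  by apply: lt_le_trans Sy_lt _; rewrite ge_min lexx orbT.
rewrite ltr_pdivlMr// mulrDr mulr1 => h.
have := nrm_ge0 (S n y); move: (nrm (S n y)) h => s h s0.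
have : B * s = s * B by rewrite mulrC.
have [s1|s1] := ltP 0 s; first by lra.
have s2 : s = 0 by apply/eqP; rewrite eq_le s1 s0.
by rewrite s2 mulr0; lra.
Qed.

End WeakControl.

(** * A maximum principle for resolvents *)

Section MaximumPrinciple.
Context {R : realType}.

Definition square (r : R) : set (R * R) := [set` `[- r, r]] `*` [set` `[- r, r]].

Lemma squareP (r : R) (p : R * R) : square r p <-> `|p.1| <= r /\ `|p.2| <= r.
Proof. by rewrite /square /= !in_itv /= !ler_norml. Qed.

(** A discrete mean value inequality with an error of third order is enough for
    the maximum principle: adding a small multiple of [x ^ 2 + y ^ 2], whose
    discrete Laplacian is of second order, rules out interior maxima. *)
Lemma square_maximum_principle (g : R * R -> R) (r B : R) : 0 < r ->
  {in square r, continuous g} ->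
  (forall x y, `|x| < r -> `|y| < r -> exists (k d : R), 0 < d /\
     forall h, 0 < h < d -> 4 * g (x, y) <=
       g (x + h, y) + g (x - h, y) + g (x, y + h) + g (x, y - h) + k * h ^+ 3) ->
  (forall x y, `|x| <= r -> `|y| <= r -> `|x| = r \/ `|y| = r -> g (x, y) <= B) ->
  g (0, 0) <= B.
Proof.
move=> r0 gc mean bdry; apply/ler_addgt0Pr => e e0.
(* On the square [x ^ 2 + y ^ 2 <= 2 r ^ 2], so the added term is at most [e]. *)
pose del := e / (2 * r ^+ 2).
have r2 : 0 < r ^+ 2 by rewrite exprn_gt0.
have del0 : 0 < del by rewrite divr_gt0// mulr_gt0.
pose phi (p : R * R) := g p + del * (p.1 * p.1 + p.2 * p.2).
have phic : {within square r, continuous phi}.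
  apply: continuous_in_subspaceT => p pr; apply: cvgD; first exact: gc.
  apply: cvgM; first exact: cvg_cst.
  by apply: cvgD; apply: cvgM; (exact: cvg_fst || exact: cvg_snd).
have sq0 : square r (0, 0) by apply/squareP; rewrite /= normr0 ltW.
have cs : compact (square r) by apply: compact_setX; exact: segment_compact.
have [[x y] xyr maxp] := compact_EVT_max (ex_intro _ _ sq0) cs phic.
have [/= xr yr] := (squareP r (x, y)).1 (set_mem xyr).
have le_max p : `|p.1| <= r -> `|p.2| <= r -> phi p <= phi (x, y).
  by move=> p1 p2; apply: maxp; apply/mem_set/squareP.
have sqle (t : R) : `|t| <= r -> t * t <= r ^+ 2.
  by move=> tr; apply: le_trans (ler_norm _) _; rewrite normrM; exact: ler_pM.
have bdry_case : g (x, y) <= B -> g (0, 0) <= B + e.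
  move=> gB; have := le_max (0, 0); rewrite /phi /= !normr0 !mulr0 addr0 mulr0 addr0.
  move=> /(_ (ltW r0) (ltW r0)) h.
  have : del * (x * x + y * y) <= del * (2 * r ^+ 2).
    by rewrite ler_pM2l//; have := sqle x xr; have := sqle y yr; lra.
  by rewrite {2}/del divfK ?gt_eqF ?mulr_gt0//; lra.
have [xb|xi] := eqVneq `|x| r; first by apply/bdry_case/bdry => //; left.
have [yb|yi] := eqVneq `|y| r; first by apply/bdry_case/bdry => //; right.
have {xi}xi : `|x| < r by rewrite lt_def eq_sym xi.
have {yi}yi : `|y| < r by rewrite lt_def eq_sym yi.
exfalso; have [k [d [d0 hk]]] := mean x y xi yi.
have k1 : 0 < `|k| + 1 by rewrite ltr_wpDl.
pose h := Num.min (Num.min (d / 2) (del / (`|k| + 1))) (Num.min (r - `|x|) (r - `|y|)).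
have h0 : 0 < h by rewrite !lt_min !subr_gt0 xi yi (divr_gt0 d0)// (divr_gt0 del0 k1).
have hd : h < d.
  apply: (@le_lt_trans _ _ (d / 2)); last by rewrite ltr_pdivrMr//; lra.
  by rewrite !ge_min lexx.
have hx : h <= r - `|x| by rewrite !ge_min lexx !orbT.
have hy : h <= r - `|y| by rewrite !ge_min lexx !orbT.
have hdel : h * (`|k| + 1) <= del.
  by rewrite -ler_pdivlMr// !ge_min lexx orbT.
have hk2 := hk h _; rewrite h0 hd /= in hk2; have {hk2} := hk2 isT.
have habs := gtr0_norm h0.
have tri (s t : R) : `|s| <= r -> `|t| <= r - `|s| -> `|s + t| <= r.
  by move=> _ tr; apply: le_trans (ler_normD _ _) _; lra.
have m1 : phi (x + h, y) <= phi (x, y).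
  by apply: le_max => //=; apply: tri => //; rewrite habs.
have m2 : phi (x - h, y) <= phi (x, y).
  by apply: le_max => //=; apply: tri => //; rewrite normrN habs.
have m3 : phi (x, y + h) <= phi (x, y).
  by apply: le_max => //=; apply: tri => //; rewrite habs.
have m4 : phi (x, y - h) <= phi (x, y).
  by apply: le_max => //=; apply: tri => //; rewrite normrN habs.
move: m1 m2 m3 m4; rewrite /phi /=.
move: (g (x + h, y)) (g (x - h, y)) (g (x, y + h)) (g (x, y - h)) (g (x, y)).
move=> g1 g2 g3 g4 g0 m1 m2 m3 m4 m0.
(* At a maximum the gain [4 del h ^ 2] of the four neighbours is compensated by the
   error [k h ^ 3]. *)
have key : 4 * del * h ^+ 2 <= k * h ^+ 3.
  rewrite !expr2 !exprS expr0 in m0 *; lra.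
have hh : 0 < h ^+ 2 by rewrite exprn_gt0.
have : 4 * del <= k * h.
  by rewrite -(ler_pM2r hh) -[k * h * _]mulrA -exprS.
have : k * h <= h * (`|k| + 1).
  by rewrite mulrC ler_pM2l//; have := ler_norm k; lra.
lra.
Qed.

End MaximumPrinciple.

Section ResolventMaximum.
Context {R : realType} {H0 : completeNormedModType (C R)}.
Implicit Types (W : set H0) (M : nat).

(** The residual of the quadratic polynomial [p] in [h] of [resolvent_jet]: [f] and
    [x + y] are the images under [T mu] of its (negated) coefficients, and all terms
    below the third order cancel. *)
Lemma jet_cancel (h : C R) (u f x y c1 c2 d q : H0) :
  u - h *: f - h ^+ 2 *: (x + y) + (h *: (f + h *: x + h ^+ 2 *: c1) +
    h ^+ 2 *: (y + h *: c2 + h ^+ 2 *: d) + h ^+ 3 *: q) - u =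
  h ^+ 3 *: ((c1 + c2) + h *: d + q).
Proof.
rewrite !scalerDr !scalerA -!exprS -exprD -!exprSr -[h * h]expr2 !opprD !addrA.
rewrite [LHS](ACl (1*12*5*2*6*3*8*4*7*9*10*11))/=.
by rewrite subrr add0r subrr add0r subrr add0r subrr add0r.
Qed.

(** The coefficients are found by comparing powers of [h] in
    [T (mu + h) p = u]; the remainder is of third order because [T (mu + h)] is
    bounded below uniformly for small [h]. *)
Lemma resolvent_jet W M (A : 'I_M.+1 -> operator H0) K mu u :
  bounded_pencil W A K -> boundedly_invertible W (pencil A mu) -> W u ->
  exists (a1 a2 : H0) (k d : R), 0 <= k /\ 0 < d /\
  forall h, nrm h < d -> boundedly_invertible W (pencil A (mu + h)) ->
    nrm (inverse (pencil A (mu + h)) u -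
         (inverse (pencil A mu) u + h *: a1 + h ^+ 2 *: a2)) <= k * nrm h ^+ 3.
Proof.
move=> bA inv Wu; have lT nu := pencil_linear nu bA.
have sD := proj1 (bp_lin bA ord0).
have sW := bp_sub bA; have DW := bp_dom0 bA.
have [_ _ [k0 k00 low]] := (boundedly_invertibleP W (lT mu)).1 inv.
have [L L0 lip] := pencil_lipschitz (H0 := H0) M mu (bp_ge0 bA).
have [b1 [b2 [q [kq [kq0 jet]]]]] := pencil_jet (H0 := H0) M mu.
pose G := inverse (pencil A mu).
have WB c x : W x -> W (perturbation A c x) by exact: (perturbation_in _ bA).
have dG y : W y -> dom (A ord0) (G y) by exact: (inverse_in inv).
have TG y : W y -> pencil A mu (G y) = y by exact: (inverseK inv).
pose a0 := G u; have da0 : dom (A ord0) a0 by exact: dG.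
pose f1 := perturbation A b1 a0; have Wf1 : W f1 by exact/WB/DW.
pose a1 := - G f1.
have da1 : dom (A ord0) a1 by rewrite /a1 -scaleN1r; apply: (subspaceZ _ sD); exact: dG.
pose f2 := perturbation A b1 a1 + perturbation A b2 a0.
have Wf2 : W f2 by apply: (subspaceD sW); exact/WB/DW.
pose a2 := - G f2.
have da2 : dom (A ord0) a2 by rewrite /a2 -scaleN1r; apply: (subspaceZ _ sD); exact: dG.
have TN y : W y -> pencil A mu (- G y) = - y.
  by move=> Wy; rewrite -scaleN1r (linopZ _ (lT mu) (dG _ Wy)) TG// scaleN1r.
(* [f1] and [f2] are minus the images of [a1] and [a2] under [T mu]; [Z] bounds
   the third-order residual. *)
pose Z := nrm (perturbation A b1 a2 + perturbation A b2 a1) +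
  nrm (perturbation A b2 a2) + kq * K * (nrm a0 + nrm a1 + nrm a2).
have Z0 : 0 <= Z.
  by rewrite !addr_ge0 ?nrm_ge0// mulr_ge0 ?addr_ge0 ?nrm_ge0// mulr_ge0// (bp_ge0 bA).
exists a1, a2, (2 * k0 * Z), (Num.min 1 (2 * L * (k0 + 1))^-1).
split; first by rewrite !mulr_ge0.
have k1 : 0 < 2 * L * (k0 + 1) by rewrite !mulr_gt0// ltr_wpDl.
split; first by rewrite lt_min ltr01 invr_gt0.
move=> h; rewrite lt_min => /andP[/ltW h1 hk] invh.
pose x := inverse (pencil A (mu + h)) u.
have dx : dom (A ord0) x by exact: (inverse_in invh Wu).
have Tx : pencil A (mu + h) x = u by exact: (inverseK invh Wu).
pose p := a0 + h *: a1 + h ^+ 2 *: a2.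
have dp : dom (A ord0) p.
  by apply: (subspaceD sD); [apply: (subspaceD sD) => //|]; apply: (subspaceZ _ sD).
have Wp := DW _ dp.
have lowh y : dom (A ord0) y -> nrm y <= 2 * k0 * nrm (pencil A (mu + h) y).
  move=> dy; have Wy := DW _ dy; have := low y dy.
  have hmu : mu + h - mu = h by rewrite addrC addKr.
  have := lip W A bA (mu + h) y; rewrite hmu => /(_ h1 Wy).
  set t := nrm (pencil A mu y); set s := nrm (pencil A (mu + h) y) => lp.
  have ts : t <= s + L * nrm h * nrm y.
    rewrite /t -[pencil A mu y](subKr (pencil A (mu + h) y)).
    by apply: le_trans (nrmB _ _) _; rewrite lerD2l.
  have half : k0 * (L * nrm h * nrm y) <= 2^-1 * nrm y.
    have -> : k0 * (L * nrm h * nrm y) = (L * k0 * nrm h) * nrm y by ring.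
    apply: ler_wpM2r; first exact: nrm_ge0.
    move: hk; rewrite -[X in _ < X]mul1r ltr_pdivlMr// => hk.
    have : 0 <= nrm h * L by rewrite mulr_ge0 ?nrm_ge0// ltW.
    by move: hk; clear => *; lra.
  have := ler_wpM2l k00 ts; rewrite mulrDr => kt nyt.
  by move: half kt nyt; clear => *; lra.
have err : nrm (pencil A (mu + h) p - u) <= nrm h ^+ 3 * Z.
  have [e1 bd] := jet W A K bA h p.
  have -> : pencil A (mu + h) p - u = h ^+ 3 *: ((perturbation A b1 a2 +
      perturbation A b2 a1) + h *: perturbation A b2 a2 + perturbation A (q h) p).
    have -> : pencil A (mu + h) p = pencil A mu p + (h *: perturbation A b1 p +
        h ^+ 2 *: perturbation A b2 p + h ^+ 3 *: perturbation A (q h) p).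
      by rewrite -e1 [RHS]addrC subrK.
    have pert c : perturbation A c p = perturbation A c a0 +
        h *: perturbation A c a1 + h ^+ 2 *: perturbation A c a2.
      have W0 := DW _ da0; have W1 := DW _ da1; have W2 := DW _ da2.
      have Wh1 := subspaceZ h sW W1; have Wh2 := subspaceZ (h ^+ 2) sW W2.
      rewrite (perturbationD c bA (subspaceD sW W0 Wh1) Wh2).
      by rewrite (perturbationD c bA W0 Wh1) !(perturbationZ c _ bA).
    have Tp : pencil A mu p = u - h *: f1 - h ^+ 2 *: f2.
      have dh1 := subspaceZ h sD da1; have dh2 := subspaceZ (h ^+ 2) sD da2.
      rewrite (linopD (lT mu) (subspaceD sD da0 dh1) dh2).
      rewrite (linopD (lT mu) da0 dh1) (linopZ _ (lT mu) da1) (linopZ _ (lT mu) da2).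
      by rewrite !TN// TG// !scalerN.
    by rewrite Tp (pert b1) (pert b2) jet_cancel.
  rewrite nrmZ -nrmX; apply: ler_wpM2l; first exact: nrm_ge0.
  apply: le_trans (nrmD _ _) _; apply: lerD.
    apply: le_trans (nrmD _ _) _; rewrite lerD2l nrmZ.
    by rewrite -[leRHS]mul1r ler_wpM2r ?nrm_ge0.
  apply: le_trans (bd h1 Wp) _; apply: ler_wpM2l.
    by rewrite mulr_ge0// (bp_ge0 bA).
  have h2 : nrm (h ^+ 2) <= 1 by rewrite nrmX expr_le1// nrm_ge0.
  apply: le_trans (nrmD _ _) _; apply: lerD.
    apply: le_trans (nrmD _ _) _; rewrite lerD2l nrmZ.
    by rewrite -[leRHS]mul1r ler_wpM2r ?nrm_ge0.
  by rewrite nrmZ -[leRHS]mul1r ler_wpM2r ?nrm_ge0.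
apply: le_trans (lowh _ (subspaceB sD dx dp)) _.
rewrite (linopB (lT (mu + h)) dx dp) Tx nrm_distC -[2 * k0 * Z * _]mulrA [Z * _]mulrC.
by apply: ler_wpM2l err; rewrite mulr_ge0.
Qed.


(** The linear terms cancel within the pairs [w, - w] and [i w, - i w], the
    quadratic ones between these pairs. *)
Lemma four_point_sum (a0 a1 a2 : H0) (w : C R)
    (g := fun z : C R => a0 + z *: a1 + z ^+ 2 *: a2) :
  4 *: a0 = g w + g (- w) + g ('i * w) + g (- ('i * w)).
Proof.
rewrite /g !sqrrN exprMn sqrCi mulN1r !scaleNr !addrA.
rewrite [RHS](ACl (1*4*7*10*2*5*8*11*3*9*6*12))/= .
by rewrite !addrK scaler_nat !mulrSr mulr0n add0r.
Qed.

(** Squares are compact as products of intervals, so the parameter plane is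
    described by its two real coordinates. *)
Definition pt (p : R * R) : C R := (p.1 +i* p.2)%C.

Lemma ptB p q : pt p - pt q = pt (p.1 - q.1, p.2 - q.2).
Proof. by []. Qed.

Lemma nrm_pt_le p : nrm (pt p) <= `|p.1| + `|p.2|.
Proof.
have -> : pt p = ((p.1)%:C)%C + 'i * ((p.2)%:C)%C.
  by apply/eqP; rewrite /pt; simpc.
apply: le_trans (nrmD _ _) _; rewrite nrmM !nrm_real.
by rewrite {1}/nrm normCi mul1r.
Qed.

Lemma pt_le_nrm p : `|p.1| <= nrm (pt p) /\ `|p.2| <= nrm (pt p).
Proof.
rewrite /nrm /pt /=; case: p => a b /=; rewrite -!sqrtr_sqr.
by split; rewrite ler_wsqrtr// ?lerDl ?lerDr sqr_ge0.
Qed.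

(** Lower bounds for the pencil are upper bounds for its resolvent, and the norm
    of the resolvent applied to a fixed vector satisfies the discrete mean value
    inequality by [resolvent_jet] and [four_point_sum]. *)
Lemma resolvent_maximum_principle W M (A : 'I_M.+1 -> operator H0) K lam (r k : R) :
  bounded_pencil W A K -> 0 < r ->
  (forall mu, nrm (mu - lam) < 3 * r -> boundedly_invertible W (pencil A mu)) ->
  (forall p, square r p -> `|p.1| = r \/ `|p.2| = r ->
     forall x, dom (A ord0) x -> nrm x <= k * nrm (pencil A (lam + pt p) x)) ->
  forall x, dom (A ord0) x -> nrm x <= k * nrm (pencil A lam x).
Proof.
move=> bA r0 inv bdry x Ax; set u := pencil A lam x.
have Wu : W u by exact: (pencil_in _ bA Ax).
pose f p := inverse (pencil A (lam + pt p)) u.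
have lam0 : lam + pt (0, 0) = lam by rewrite -[RHS]addr0; congr (_ + _).
have f0 : f (0, 0) = x.
  rewrite /f lam0; apply: (inverseVK (W := W)) => //; apply: inv.
  by rewrite subrr nrm0 mulr_gt0.
have invp p : `|p.1| + `|p.2| < 3 * r -> boundedly_invertible W (pencil A (lam + pt p)).
  by move=> pr; apply: inv; rewrite addrC addKr; apply: le_lt_trans pr; exact: nrm_pt_le.
have near p q : lam + pt q = lam + pt p + (pt q - pt p).
  by rewrite -addrA; congr (_ + _); rewrite addrC subrK.
have jet p : square r p -> exists a1 a2 k' d, 0 <= k' /\ 0 < d /\
    forall q, `|q.1 - p.1| + `|q.2 - p.2| < d ->
      nrm (f q - (f p + (pt q - pt p) *: a1 + (pt q - pt p) ^+ 2 *: a2)) <=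
        k' * nrm (pt q - pt p) ^+ 3.
  move=> /squareP[p1 p2]; have invP := invp p _.
  have [|a1 [a2 [k' [d [k'0 [d0 jet]]]]]] := resolvent_jet bA (invP _) Wu; first lra.
  exists a1, a2, k', (Num.min d r); split=> //; split; first by rewrite lt_min d0.
  move=> q; rewrite lt_min => /andP[qd qr]; rewrite /f (near p q); apply: jet.
    by rewrite ptB; apply: le_lt_trans qd; exact: nrm_pt_le.
  rewrite -near; apply: invp.
  have h1 := ler_normD (q.1 - p.1) p.1; have h2 := ler_normD (q.2 - p.2) p.2.
  by rewrite !subrK in h1 h2; lra.
rewrite -f0.
apply: (@square_maximum_principle R (fun p => nrm (f p)) r) => //.
- move=> p /set_mem pr; have [a1 [a2 [k' [d [k'0 [d0 hd]]]]]] := jet p pr.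
  apply/cvgrPdist_lt => e e0.
  pose s := nrm a1 + nrm a2 + k' + 1.
  have s0 : 0 < s by rewrite ltr_wpDl// !addr_ge0 ?nrm_ge0.
  pose t := Num.min (Num.min d 1) (e / s) / 2.
  have t0 : 0 < t by rewrite divr_gt0// !lt_min d0 ltr01 divr_gt0.
  have [td t1 te] : [/\ t * 2 <= d, t * 2 <= 1 & t * 2 <= e / s].
    by rewrite /t divfK ?pnatr_eq0// !ge_min !lexx !orbT.
  exists (ball p.1 t, ball p.2 t); first by split; exact: nbhsx_ballx.
  move=> q [/= q1 q2]; rewrite /ball /= in q1 q2.
  rewrite distrC in q1; rewrite distrC in q2.
  have small : `|q.1 - p.1| + `|q.2 - p.2| < t * 2 by lra.
  have := hd q (lt_le_trans small td).
  have hh := le_lt_trans (nrm_pt_le (q.1 - p.1, q.2 - p.2)) small.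
  rewrite -ptB in hh; set h := pt q - pt p in hh *.
  have h1 : nrm h <= 1 by apply: ltW; exact: lt_le_trans hh t1.
  have h2 : nrm h ^+ 2 <= nrm h by rewrite expr2 -[leRHS]mul1r ler_wpM2r ?nrm_ge0.
  have h3 : nrm h ^+ 3 <= nrm h.
    by rewrite exprS -[leRHS]mulr1 ler_wpM2l ?nrm_ge0//; exact: le_trans h2 h1.
  move=> fq.
  have fd : nrm (f q - f p) <= nrm h * (nrm a1 + nrm a2 + k').
    have eqA (v : H0) : f q - f p = f q - (f p + v) + v.
      by rewrite opprD [in RHS]addrA subrK.
    rewrite (eqA (h *: a1 + h ^+ 2 *: a2)) [f p + _]addrA.
    apply: le_trans (nrmD _ _) _; apply: le_trans (lerD fq (nrmD _ _)) _.
    rewrite !nrmZ nrmX.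
    have e1 := ler_wpM2l k'0 h3; have e2 := ler_wpM2r (nrm_ge0 a2) h2.
    by move: e1 e2; clear => *; lra.
  apply: le_lt_trans (nrm_lip _ _) _; rewrite nrm_distC.
  apply: le_lt_trans fd _.
  have : nrm h * s < e.
    by rewrite -ltr_pdivlMr//; exact: lt_le_trans hh te.
  by have := nrm_ge0 h; rewrite /s; clear => *; lra.
- move=> a b ar br.
  have pr : square r (a, b) by apply/squareP; rewrite /= !ltW.
  have [a1 [a2 [k' [d [k'0 [d0 hd]]]]]] := jet _ pr.
  exists (4 * k'), d; split => // h /andP[h0 hlt].
  set w : C R := (h%:C)%C.
  have nw : nrm w = h by rewrite nrm_real gtr0_norm.
  pose g q := f (a, b) + q *: a1 + q ^+ 2 *: a2.
  have close x1 y1 q : pt (x1, y1) - pt (a, b) = q -> nrm q = h ->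
      `|x1 - a| + `|y1 - b| < d -> nrm (g q) <= nrm (f (x1, y1)) + k' * h ^+ 3.
    move=> qE qh /(hd (x1, y1)); rewrite qE qh -/(g q) => e1.
    rewrite -[g q](subKr (f (x1, y1))); apply: le_trans (nrmB _ _) _.
    by rewrite lerD2l.
  have ah := gtr0_norm h0.
  have c1 := close (a + h) b w; have c2 := close (a - h) b (- w).
  have c3 := close a (b + h) ('i * w); have c4 := close a (b - h) (- ('i * w)).
  have da t : a + t - a = t by rewrite addrC addKr.
  have db t : b + t - b = t by rewrite addrC addKr.
  move: c1 c2 c3 c4; rewrite !ptB /= !subrr !da !db !nrmN !normrN ah normr0 addr0 add0r.
  rewrite nrmM nw [nrm 'i]/nrm normCi mul1r.
  have r1 : pt (h, 0) = w by [].
  have r2 : pt (- h, 0) = - w by rewrite /w /pt; simpc.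
  have r3 : pt (0, h) = 'i * w by rewrite /w /pt; simpc.
  have r4 : pt (0, - h) = - ('i * w) by rewrite /w /pt; simpc.
  move=> /(_ r1 erefl hlt) c1 /(_ r2 erefl hlt) c2 /(_ r3 erefl hlt) c3 /(_ r4 erefl hlt) c4.
  have <- : nrm (4 *: f (a, b)) = 4 * nrm (f (a, b)).
    by rewrite nrmZ; congr (_ * _); apply: realI; rewrite -nrmE normr_nat real_nat.
  have -> : 4 *: f (a, b) = g w + g (- w) + g ('i * w) + g (- ('i * w)).
    exact: four_point_sum.
  apply: le_trans (nrmD _ _) _; apply: le_trans (lerD (nrmD _ _) (lexx _)) _.
  apply: le_trans (lerD (lerD (nrmD _ _) (lexx _)) (lexx _)) _.
  have comb (g1 g2 g3 g4 f1 f2 f3 f4 t : R) : g1 <= f1 + t -> g2 <= f2 + t ->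
      g3 <= f3 + t -> g4 <= f4 + t -> g1 + g2 + g3 + g4 <= f1 + f2 + f3 + f4 + 4 * t.
    by clear; lra.
  have key := comb _ _ _ _ _ _ _ _ _ c1 c2 c3 c4.
  rewrite -mulrA.
  exact: key.
- move=> a b ar br onb.
  have pr : square r (a, b) by apply/squareP.
  have invab : boundedly_invertible W (pencil A (lam + pt (a, b))).
    by apply: invp => /=; clear -ar br r0; lra.
  have dab : dom (A ord0) (f (a, b)) by exact: (inverse_in invab Wu).
  apply: le_trans (bdry _ pr onb _ dab) _.
  by rewrite /f (inverseK invab Wu).
Qed.

End ResolventMaximum.

(** * Strongly convergent families of pencils *)

Section Family.
Context {R : realType} {H0 : completeNormedModType (C R)}
  {dot : {dot H0 for conjC}}.
Context (dot_norm : forall x : H0, `|x| ^+ 2 = dot x x).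

Lemma cvg_lincomb (I : finType) (Q : pred I) (c : I -> C R) (F : I -> nat -> H0)
    (l : I -> H0) : (forall i, Q i -> F i @ \oo --> l i) ->
  \sum_(i | Q i) c i *: F i n @[n --> \oo] --> \sum_(i | Q i) c i *: l i.
Proof.
move=> Fl; apply/cvg_nrmP.
have : \sum_(i <- index_enum I | Q i) nrm (c i) * nrm (F i n - l i) @[n --> \oo] --> (0 : R).
  elim: (index_enum I) => [|i r IH].
    by under eq_fun do rewrite big_nil; exact: cvg_cst.
  under eq_fun do rewrite big_cons; case Qi : (Q i) => //.
  by apply: cvg0D => //; apply: cvg0Ml; apply/cvg_nrmP; exact: Fl.
apply: cvg0_le => n; rewrite nrm_ge0 -sumrB; apply: le_trans (nrm_sum _ _ _) _.
by apply: ler_sum => i _; rewrite -scalerBr nrmZ.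
Qed.

Context (H : set H0) (Hn : nat -> set H0) (P : H0 -> H0) (Pn : nat -> H0 -> H0).
Context (H_sub : linear_subspace H).
Context (Hn_sub : forall n, linear_subspace (Hn n)).
Context (P_proj : orthogonal_projection dot H P).
Context (Pn_proj : forall n, orthogonal_projection dot (Hn n) (Pn n)).
Context (Pn_P : strong_cvg Pn P).

Lemma strong_cvg_along (Kn : nat -> H0 -> H0) (k : H0) (K : R) (vn : nat -> H0) v :
  0 <= K -> (forall n x y, Hn n x -> Hn n y -> Kn n (x - y) = Kn n x - Kn n y) ->
  (forall n x, Hn n x -> nrm (Kn n x) <= K * nrm x) ->
  H v -> Kn n (Pn n v) @[n --> \oo] --> k ->
  (forall n, Hn n (vn n)) -> vn @ \oo --> v ->
  Kn n (vn n) @[n --> \oo] --> k.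
Proof.
move=> K_ge0 lin bd Hv Kv Hvn vnv; apply/cvg_nrmP.
have PnPv : Pn n v @[n --> \oo] --> v.
  by rewrite -[X in _ --> X](proj_id H_sub P_proj Hv); exact: Pn_P.
have lim : K * (nrm (vn n - v) + nrm (Pn n v - v)) + nrm (Kn n (Pn n v) - k)
    @[n --> \oo] --> (0 : R).
  apply: cvg0D; last exact/cvg_nrmP.
  by apply: cvg0Ml; apply: cvg0D; exact/cvg_nrmP.
move: lim; apply: cvg0_le => n; rewrite nrm_ge0 /=.
have [HPn _] := Pn_proj n v.
have -> : Kn n (vn n) - k = Kn n (vn n - Pn n v) + (Kn n (Pn n v) - k).
  by rewrite lin// addrA subrK.
apply: le_trans (nrmD _ _) _; rewrite lerD2r.
apply: le_trans (bd n _ (subspaceB (Hn_sub n) (Hvn n) HPn)) _.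
apply: ler_wpM2l => //; apply: le_trans (nrmB _ _).
by rewrite opprB addrA subrK.
Qed.

Context (M : nat) (A : 'I_M.+1 -> operator H0)
  (An : nat -> 'I_M.+1 -> operator H0) (K : R).
Context (bA : bounded_pencil H A K).
Context (bAn : forall n, bounded_pencil (Hn n) (An n) K).
Context (lam0 : C R).
Context (inv0 : boundedly_invertible H (pencil A lam0)).
Context (inv0n : forall n, boundedly_invertible (Hn n) (pencil (An n) lam0)).
Context (resolvent_cvg :
  strong_cvg (fun n x => inverse (pencil (An n) lam0) (Pn n x))
             (fun x => inverse (pencil A lam0) (P x))).
Context (coef_cvg : forall j, j != ord0 ->
  strong_cvg (fun n x => An n j (Pn n x)) (fun x => A j (P x))).

Lemma projections_cvg x : H x -> Pn n x @[n --> \oo] --> x.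
Proof.
by move=> Hx; rewrite -[X in _ --> X](proj_id H_sub P_proj Hx); exact: Pn_P.
Qed.

(** The approximations are obtained at [lam0] from the convergence of the
    resolvents, and the other parameters differ by a strongly convergent bounded
    perturbation. *)
Lemma graph_approximation x : dom (A ord0) x ->
  exists vn : nat -> H0,
    [/\ forall n, dom (An n ord0) (vn n), vn @ \oo --> x &
        forall mu, pencil (An n) mu (vn n) @[n --> \oo] --> pencil A mu x].
Proof.
move=> Ax; set u := pencil A lam0 x.
have Hu : H u by exact: (pencil_in _ bA Ax).
have HPn n : Hn n (Pn n u) by have [] := Pn_proj n u.
pose vn n := inverse (pencil (An n) lam0) (Pn n u).
have dvn n : dom (An n ord0) (vn n) by exact: (inverse_in (inv0n n) (HPn n)).
have Tvn n : pencil (An n) lam0 (vn n) = Pn n u by exact: (inverseK (inv0n n) (HPn n)).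
have vx : vn @ \oo --> x.
  have := @resolvent_cvg u; rewrite (proj_id H_sub P_proj Hu).
  by rewrite (inverseVK inv0 Ax).
exists vn; split => // mu.
have Hx := bp_dom0 bA Ax.
have Hvn n := bp_dom0 (bAn n) (dvn n).
pose c (j : 'I_M.+1) : C R := mu ^+ j - lam0 ^+ j.
have -> : (fun n => pencil (An n) mu (vn n)) =
    (fun n => Pn n u + perturbation (An n) c (vn n)).
  by apply/funext => n; rewrite -Tvn -pencilB addrC subrK.
have -> : pencil A mu x = u + perturbation A c x by rewrite -pencilB addrC subrK.
apply: cvgD; first exact: projections_cvg.
apply: cvg_lincomb => j j0.
apply: (strong_cvg_along (Kn := fun n => An n j) (bp_ge0 bA) _ _ Hx _ Hvn vx).
- by move=> n y y' Hy Hy'; apply: linopB (bp_lin (bAn n) j) _ _; rewrite (bp_dom (bAn n)).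
- by move=> n y Hy; exact: bp_bound (bAn n) _ _ j0 Hy.
- by have := @coef_cvg j j0 x; rewrite (proj_id H_sub P_proj Hx).
Qed.

Context (resolvent_adjoint_cvg :
  strong_cvg
    (fun n x => adjoint dot (Hn n) (inverse (pencil (An n) lam0)) (Pn n x))
    (fun x => adjoint dot H (inverse (pencil A lam0)) (P x))).
Context (coef_adjoint_cvg : forall j, j != ord0 ->
  strong_cvg (fun n x => adjoint dot (Hn n) (An n j) (Pn n x))
             (fun x => adjoint dot H (A j) (P x))).

(** Values of a pencil at different parameters differ by bounded operators, so
    their adjoints have the same domain and differ by the adjoints of these
    operators. *)
Lemma adjoint_rel_shift W (B : 'I_M.+1 -> operator H0) lam mu w z :
  bounded_pencil W B K -> adjoint_rel dot W (pencil B mu) w z ->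
  adjoint_rel dot W (pencil B lam) w
    (z + \sum_(j < M.+1 | j != ord0)
           conjC (lam ^+ j - mu ^+ j) *: adjoint dot W (B j) w).
Proof.
move=> bB [Ww Wz hz].
have rel j : j != ord0 -> adjoint_rel dot W (B j) w (adjoint dot W (B j) w).
  move=> j0; have [] := bounded_adjoint dot_norm (bp_lin bB j) (bp_dom bB j0)
    (bp_closed bB) (fun x => bp_bound bB j0) Ww; by [].
split=> //.
  apply: (subspaceD (bp_sub bB)) => //; apply: (subspace_sum _ (bp_sub bB)) => j j0.
  by apply: (subspaceZ _ (bp_sub bB)); have [] := rel j j0.
move=> x Bx; rewrite dotDr -hz//.
have Wx := bp_dom0 bB Bx.
have -> : pencil B lam x = pencil B mu x + perturbation B (fun j => lam ^+ j - mu ^+ j) x.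
  by rewrite -pencilB addrC subrK.
rewrite dotDl; congr (_ + _); rewrite linear_sumr linear_sumlz /=.
apply: eq_bigr => j j0; rewrite dotZl dotZr conjCK.
by have [_ _ ->] := rel j j0; rewrite ?(bp_dom bB j0).
Qed.

(** The dual of [graph_approximation]: the adjoint resolvents at [lam0] provide the
    approximations. *)
Lemma adjoint_graph_approximation mu w z :
  adjoint_rel dot H (pencil A mu) w z ->
  exists wn zn : nat -> H0, [/\ wn @ \oo --> w, zn @ \oo --> z &
    forall n, adjoint_rel dot (Hn n) (pencil (An n) mu) (wn n) (zn n)].
Proof.
move=> rel; have relS := adjoint_rel_shift lam0 bA rel.
set u := z + _ in relS; have [Hw Hu hu] := relS; have [_ Hz _] := rel.
have HPn n : Hn n (Pn n u) by have [] := Pn_proj n u.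
pose wn n := adjoint dot (Hn n) (inverse (pencil (An n) lam0)) (Pn n u).
have relI n := adjoint_inverse_rel dot_norm (pencil_linear lam0 (bAn n)) (Hn_sub n)
  (bp_closed (bAn n)) (inv0n n) (HPn n).
have Hwn n : Hn n (wn n) by have [] := relI n.
have ww : wn @ \oo --> w.
  have := @resolvent_adjoint_cvg u; rewrite (proj_id H_sub P_proj Hu).
  rewrite (adjointE (A := inverse (pencil A lam0)) (z := w) dot_norm H_sub) //.
  - by rewrite (dom_inverse inv0).
  - by rewrite (dom_inverse inv0); exact: subset_closure.
  - split=> // y; rewrite (dom_inverse inv0) => Hy.
    by rewrite -hu ?(inverseK inv0 Hy)//; exact: (inverse_in inv0 Hy).
have rel0 n : adjoint_rel dot (Hn n) (pencil (An n) lam0) (wn n) (Pn n u).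
  split=> // x Ax; have [_ _ hw] := relI n.
  have HT := pencil_in lam0 (bAn n) Ax.
  by rewrite -hw ?(dom_inverse (inv0n n))// (inverseVK (inv0n n)).
pose zn n := Pn n u + \sum_(j < M.+1 | j != ord0)
  conjC (mu ^+ j - lam0 ^+ j) *: adjoint dot (Hn n) (An n j) (wn n).
exists wn, zn; split=> //; last by move=> n; exact: adjoint_rel_shift.
have -> : z = u + \sum_(j < M.+1 | j != ord0)
    conjC (mu ^+ j - lam0 ^+ j) *: adjoint dot H (A j) w.
  rewrite /u -addrA -big_split /= big1 ?addr0// => j j0.
  by rewrite -scalerDl -rmorphD /= addrA subrK subrr rmorph0 scale0r.
apply: cvgD; first exact: projections_cvg.
apply: cvg_lincomb => j j0.
have bdj n y : Hn n y -> adjoint_rel dot (Hn n) (An n j) y (adjoint dot (Hn n) (An n j) y) /\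
    nrm (adjoint dot (Hn n) (An n j) y) <= K * nrm y.
  apply: (bounded_adjoint dot_norm (bp_lin (bAn n) j) (bp_dom (bAn n) j0)
    (bp_closed (bAn n))) => x; exact: bp_bound (bAn n) _ _ j0.
apply: (strong_cvg_along (Kn := fun n => adjoint dot (Hn n) (An n j))
  (bp_ge0 bA) _ _ Hw _ Hwn ww).
- move=> n y y' Hy Hy'; apply: linopB.
  + apply: adjoint_linear => //; rewrite (bp_dom (bAn n) j0)//.
    exact: subset_closure.
  + by exists (adjoint dot (Hn n) (An n j) y); have [] := bdj n y Hy.
  + by exists (adjoint dot (Hn n) (An n j) y'); have [] := bdj n y' Hy'.
- by move=> n y Hy; have [] := bdj n y Hy.
- by have := @coef_adjoint_cvg j j0 w; rewrite (proj_id H_sub P_proj Hw).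
Qed.

Let T mu := pencil A mu.
Let Tn n mu := pencil (An n) mu.

(** Vectors of [H] are in the range of the adjoint of [T mu], and
    [adjoint_graph_approximation] applies to their preimages. *)
Lemma pencils_weakly_controlled mu : boundedly_invertible H (T mu) ->
  weakly_controlled (dot := dot) (fun n => Tn n mu).
Proof.
move=> invmu; apply: (weak_control dot_norm Hn_sub P_proj Pn_proj Pn_P).
  by move=> n; exact: bp_dom0 (bAn n).
move=> z Hz; have lT := pencil_linear mu bA.
pose w := adjoint dot H (inverse (T mu)) z.
have [_ Hw hw] := adjoint_inverse_rel dot_norm lT H_sub (bp_closed bA) invmu Hz.
have rel : adjoint_rel dot H (T mu) w z.
  split=> // x Ax; have HT := pencil_in mu bA Ax.
  by rewrite -hw ?(dom_inverse invmu)// (inverseVK invmu).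
have [wn [zn [ww zz hn]]] := adjoint_graph_approximation rel.
by exists w, wn, zn; split=> // n x Ax; have [_ _] := hn n; exact.
Qed.

Lemma adjoint_pencils_weakly_controlled mu : boundedly_invertible H (T mu) ->
  weakly_controlled (dot := dot) (fun n => adjoint dot (Hn n) (Tn n mu)).
Proof.
move=> invmu; apply: (weak_control dot_norm Hn_sub P_proj Pn_proj Pn_P).
  by move=> n y [z []].
move=> z Hz; pose v := inverse (T mu) z.
have dv : dom (A ord0) v by exact: (inverse_in invmu Hz).
have Tv : T mu v = z by exact: (inverseK invmu Hz).
have [vn [dvn vv Tvn]] := graph_approximation dv.
exists v, vn, (fun n => Tn n mu (vn n)); split=> //; first by rewrite -Tv; exact: Tvn.
move=> n y /adjointP[_ _ hz]; rewrite (dotC (vn n)) -hz; last exact: dvn.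
by rewrite -dotC.
Qed.



Let T_linear n mu : linear_operator (Tn n mu) := pencil_linear mu (bAn n).

(** Without approximate kernels at [mu], the pencils and their adjoints are bounded
    below there, so they are boundedly invertible at all parameters in a
    neighbourhood of [mu] which does not depend on the index. *)
Lemma no_pollution mu (lamn : nat -> C R) :
  boundedly_invertible H (T mu) -> lamn @ \oo --> mu ->
  (\forall n \near \oo, ~ boundedly_invertible (Hn n) (Tn n (lamn n))) ->
  approximately_singular (dot := dot) (fun n => Tn n mu) \/
  approximately_singular (dot := dot) (fun n => adjoint dot (Hn n) (Tn n mu)).
Proof.
move=> invmu lim spec; apply: contrapT => /not_orP[ns nsadj].
have [d d0 low] := weakly_controlled_lower_bound (fun n => T_linear n mu)
  (pencils_weakly_controlled invmu) ns.
have linadj n : linear_operator (adjoint dot (Hn n) (Tn n mu)).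
  by apply: adjoint_linear => //; [exact: bp_dom0 (bAn n)|exact: bp_dense (bAn n)].
have [d' d'0 lowadj] := weakly_controlled_lower_bound linadj
  (adjoint_pencils_weakly_controlled invmu) nsadj.
have [L L0 lip] := pencil_lipschitz (H0 := H0) M mu (bp_ge0 bA).
pose e := Num.min d d'; have e0 : 0 < e by rewrite lt_min d0.
pose t := Num.min 1 (e / 2 / L); have t0 : 0 < t by rewrite lt_min ltr01 !divr_gt0.
have close : \forall n \near \oo, nrm (lamn n - mu) < t.
  by apply: cvg0_near => //; exact/cvg_nrmP.
have [n [[ni ln] [la cl]]] : exists n, (~ boundedly_invertible (Hn n) (Tn n (lamn n)) /\
    (forall x, dom (Tn n mu) x -> d * nrm x <= nrm (Tn n mu x))) /\
   ((forall x, dom (adjoint dot (Hn n) (Tn n mu)) x ->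
      d' * nrm x <= nrm (adjoint dot (Hn n) (Tn n mu) x)) /\ nrm (lamn n - mu) < t).
  apply: (@filter_ex _ \oo).
  by apply: filterI; apply: filterI.
apply: ni; move: cl; rewrite lt_min => /andP[/ltW c1 c2].
apply: (boundedly_invertible_near dot_norm (bAn n) (inv0n n) e0 (mu := mu)).
- move=> x Ax; apply: le_trans (ln x Ax); apply: ler_wpM2r; first exact: nrm_ge0.
  by rewrite ge_min lexx.
- move=> x Ax; apply: le_trans (la x Ax); apply: ler_wpM2r; first exact: nrm_ge0.
  by rewrite ge_min lexx orbT.
- move=> x Wx; apply: le_trans (lip _ _ (bAn n) _ _ c1 Wx) _.
  apply: ler_wpM2r; first exact: nrm_ge0.
  by rewrite mulrC -ler_pdivlMr// ltW.
Qed.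

(** The finitary form of the limiting essential spectrum asks for one approximate
    kernel vector at a time, and by the uniform Lipschitz bound it can be taken from
    a nearby parameter. *)
Lemma not_singular_open lam :
  ~ approximately_singular (dot := dot) (fun n => Tn n lam) ->
  exists2 d : R, 0 < d & forall mu, nrm (mu - lam) < d ->
    ~ approximately_singular (dot := dot) (fun n => Tn n mu).
Proof.
move=> ns; apply: contrapT => nd; apply: ns => e F N e0.
have [L L0 lip] := pencil_lipschitz (H0 := H0) M lam (bp_ge0 bA).
have e2 : 0 < e / 2 by rewrite divr_gt0.
pose t := Num.min 1 (e / 2 / L); have t0 : 0 < t by rewrite lt_min ltr01 !divr_gt0.
have [mu [mut sing]] : exists mu, nrm (mu - lam) < t /\
    approximately_singular (dot := dot) (fun n => Tn n mu).
  apply: contrapT => nmu; apply: nd; exists t => // mu mut sing.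
  by apply: nmu; exists mu.
have [n [x [Nn dx x1 Tx xF]]] := sing (e / 2) F N e2.
have ee : e / 2 <= e by rewrite ler_pdivrMr// ler_peMr ?ltW// ltr1n.
exists n, x; split=> //; last by move=> f /xF fx; exact: lt_le_trans fx ee.
move: mut; rewrite lt_min => /andP[/ltW c1 c2].
have := lip _ _ (bAn n) _ _ c1 (bp_dom0 (bAn n) dx); rewrite x1 mulr1 => Tmu.
rewrite -[Tn n lam x](subKr (Tn n mu x)); apply: le_lt_trans (nrmB _ _) _.
rewrite (splitr e); apply: ltrD => //; apply: le_lt_trans Tmu _.
by rewrite mulrC -ltr_pdivlMr.
Qed.

(** Uniformity in the parameter prepares the covering argument on the boundary of
    a square. *)
Lemma local_lower_bound mu : boundedly_invertible H (T mu) ->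
  ~ approximately_singular (dot := dot) (fun n => Tn n mu) ->
  exists (k d : R) (N : nat), 0 < d /\ forall n nu, (N <= n)%N -> nrm (nu - mu) < d ->
    forall x, dom (An n ord0) x -> nrm x <= k * nrm (Tn n nu x).
Proof.
move=> invmu ns.
have [d d0 [N _ low]] := weakly_controlled_lower_bound (fun n => T_linear n mu)
  (pencils_weakly_controlled invmu) ns.
have [L L0 lip] := pencil_lipschitz (H0 := H0) M mu (bp_ge0 bA).
have d2 : 0 < d / 2 by rewrite divr_gt0.
exists (d / 2)^-1, (Num.min 1 (d / 2 / L)), N; split.
  by rewrite lt_min ltr01 !divr_gt0.
move=> n nu Nn; rewrite lt_min => /andP[/ltW c1 c2] x dx.
rewrite ler_pdivlMl//.
have Wx := bp_dom0 (bAn n) dx.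
have h1 := low n Nn x dx; have h2 := lip _ _ (bAn n) _ _ c1 Wx.
have h3 := nrmB (Tn n nu x) (Tn n nu x - Tn n mu x); rewrite subKr in h3.
have h4 : L * nrm (nu - mu) * nrm x <= d / 2 * nrm x.
  by apply: ler_wpM2r; [exact: nrm_ge0|rewrite mulrC -ler_pdivlMr// ltW].
have h5 := le_trans h1 (le_trans h3 (lerD (lexx _) (le_trans h2 h4))).
lra.
Qed.

Lemma boundary_compact (r : R) :
  compact (square r `&` [set p | `|p.1| = r \/ `|p.2| = r]).
Proof.
apply: compact_closedI; first by apply: compact_setX; exact: segment_compact.
have cl (f : R * R -> R) : continuous f -> closed [set p | `|f p| = r].
  move=> cf; rewrite (_ : [set p | _] = (fun p => `|f p|) @^-1` [set r])//.
  apply: closed_comp; last exact: closed_eq.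
  by move=> p _; apply: cvg_norm; exact: cf.
by apply: closedU; apply: cl => p; [exact: cvg_fst|exact: cvg_snd].
Qed.

(** Otherwise infinitely many of the pencils are invertible on a disc around
    [lam]; a uniform lower bound on the boundary of a square then holds at [lam] by
    the maximum principle, and forces the graph approximations of [x] to zero. *)
Lemma eigenvalue_approximation lam x (r1 : R) :
  dom (A ord0) x -> x != 0 -> T lam x = 0 -> 0 < r1 ->
  (forall mu, mu != lam -> nrm (mu - lam) < r1 -> boundedly_invertible H (T mu)) ->
  ~ approximately_singular (dot := dot) (fun n => Tn n lam) ->
  forall rho : R, 0 < rho -> \forall n \near \oo, exists mu,
    ~ boundedly_invertible (Hn n) (Tn n mu) /\ nrm (mu - lam) < rho.
Proof.
move=> dx x0 Tx r10 isol ns rho rho0.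
have [d d0 nsd] := not_singular_open ns.
pose m := Num.min (Num.min rho r1) d.
have m0 : 0 < m by rewrite !lt_min rho0 r10 d0.
have [mrho mr1 md] : [/\ m <= rho, m <= r1 & m <= d].
  by rewrite !ge_min !lexx !orbT.
(* The square lies in the disc of radius [3 r = m], where all the hypotheses are
   available. *)
pose r := m / 3; have r0 : 0 < r by rewrite divr_gt0.
have r3 : 3 * r = m by rewrite /r mulrC divfK.
(* A single index serves both as lower bound for [n] and as constant, which makes
   the condition monotone for the covering argument. *)
pose bounded_from i p := forall n, (i <= n)%N -> forall y, dom (An n ord0) y ->
  nrm y <= i%:R * nrm (Tn n (lam + pt p) y).
have cov : \forall i \near \oo,
    square r `&` [set p | `|p.1| = r \/ `|p.2| = r] `<=` bounded_from i.
  have nc := (compact_near_coveringP _).1 (@boundary_compact r).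
  apply: (nc nat \oo bounded_from _).
  move=> p [/squareP[p1 p2] onb].
  have shift : lam + pt p - lam = pt p by rewrite addrC addKr.
  have ptm : nrm (pt p) < m.
    by apply: le_lt_trans (nrm_pt_le p) _; rewrite -r3; lra.
  have [g1 g2] := pt_le_nrm p.
  have pt0 : lam + pt p != lam.
    apply/eqP => h; rewrite h subrr in shift; rewrite -shift nrm0 in g1 g2.
    by case: onb => pr; rewrite pr in g1 g2 *; move: r0; rewrite ltNge ?g1 ?g2.
  have [||k [dd [N [dd0 low]]]] := @local_lower_bound (lam + pt p).
  - by apply: isol => //; rewrite shift; exact: lt_le_trans ptm mr1.
  - by apply: nsd; rewrite shift; exact: lt_le_trans ptm md.
  have d2 : 0 < dd / 2 by rewrite divr_gt0.
  exists (ball p (dd / 2), [set i | (N <= i)%N /\ k <= i%:R]).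
    split; first exact: nbhsx_ballx.
    exists (maxn N (Num.truncn `|k|).+1) => // i /=; rewrite geq_max => /andP[Ni ki].
    split=> //; apply: (le_trans (ler_norm k)); apply: ltW.
    by apply: (lt_le_trans (truncnS_gt _)); rewrite ler_nat.
  move=> [q i] [/= [q1 q2] [Ni ki]] n in_ y dy.
  have [Nn qp] : (N <= n)%N /\ nrm (lam + pt q - (lam + pt p)) < dd.
    split; first exact: leq_trans in_.
    rewrite opprD addrACA subrr add0r ptB; apply: le_lt_trans (nrm_pt_le _) _.
    rewrite /ball /= in q1 q2; rewrite distrC in q1; rewrite distrC in q2.
    by rewrite (splitr dd); exact: ltrD.
  apply: le_trans (low n _ Nn qp y dy) _.
  by apply: ler_wpM2r => //; exact: nrm_ge0.
apply: contrapT => nev.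
have [i covi] : exists i,
    square r `&` [set p | `|p.1| = r \/ `|p.2| = r] `<=` bounded_from i.
  exact: (@filter_ex _ \oo _ _ cov).
have [vn [dvn vx Tvn]] := graph_approximation dx.
have nx := nrm_gt0 x0.
have near_x : \forall n \near \oo, nrm (vn n - x) < nrm x / 2.
  by apply: cvg0_near; [exact: divr_gt0|exact/cvg_nrmP].
have near_0 : \forall n \near \oo, i%:R * nrm (Tn n lam (vn n) - 0) < nrm x / 2.
  apply: cvg0_near; first exact: divr_gt0.
  by apply: cvg0Ml; apply/cvg_nrmP; rewrite -Tx; exact: Tvn.
have near_i : \forall n \near \oo, (i <= n)%N by exists i.
apply: nev; apply: filterS3 near_x near_0 near_i => n n1 n2 n3.
apply: contrapT => nn.
have inv mu : nrm (mu - lam) < 3 * r -> boundedly_invertible (Hn n) (Tn n mu).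
  rewrite r3 => mum; apply: contrapT => nmu; apply: nn; exists mu; split => //.
  exact: lt_le_trans mum mrho.
have low : nrm (vn n) <= i%:R * nrm (Tn n lam (vn n)).
  apply: (resolvent_maximum_principle (bAn n) r0 inv _ (dvn n)).
  by move=> p sp onb y dy; exact: (covi p (conj sp onb) n n3 y dy).
rewrite subr0 in n2; have h1 := nrmB (vn n) (vn n - x); rewrite subKr in h1.
have := le_lt_trans low n2; lra.
Qed.

End Family.

(** * Spectral pollution and spectral inclusion *)

Section SpectralLimits.
Context {R : realType}.

(** For each [n] a point of [Q n] is taken within the smallest [(k + 1)^-1],
    [k <= n], for which there is one. *)
Lemma select_spectral_points (Q : nat -> set (C R)) (lam : C R) :
  (forall e : R, 0 < e -> \forall n \near \oo, exists mu, Q n mu /\ nrm (mu - lam) < e) ->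
  exists2 lamn : nat -> C R, \forall n \near \oo, Q n (lamn n) & lamn @ \oo --> lam.
Proof.
move=> near_lam.
pose good n k mu := Q n mu /\ nrm (mu - lam) < k.+1%:R^-1.
have best n b : exists mu, forall k, (k <= b)%N ->
    (exists nu, good n k nu) -> good n k mu.
  elim: b => [|m [mu IH]].
    have [[nu gnu]|ng] := pselect (exists nu, good n 0%N nu).
      by exists nu => k; rewrite leqn0 => /eqP ->.
    by exists 0 => k; rewrite leqn0 => /eqP -> /ng.
  have [[nu [Qnu nunu]]|ng] := pselect (exists nu, good n m.+1 nu).
    exists nu => k km _; split => //; apply: lt_le_trans nunu _.
    by rewrite lef_pV2 ?posrE ?ltr0n // ler_nat ltnS.
  by exists mu => k; rewrite leq_eqVlt => /orP[/eqP -> /ng//|/IH].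
have /choice[lamn lamnP] := fun n => best n n.
have ev k : \forall n \near \oo, good n k (lamn n).
  have k0 : (0 : R) < k.+1%:R^-1 by rewrite invr_gt0.
  have kn : \forall n \near \oo, (k <= n)%N by exists k.
  by apply: filterS2 kn (near_lam _ k0) => n kn ex; exact: lamnP.
exists lamn; first by apply: filterS (ev 0%N) => n [].
apply/cvg_nrmP; apply: cvg0_nearP => [n|e e0]; first exact: nrm_ge0.
have [k _ hk] := near_infty_natSinv_lt (PosNum e0).
by apply: filterS (ev k) => n [_ /lt_trans]; apply; exact: hk (leqnn k).
Qed.

Context {H0 : completeNormedModType (C R)}.

Lemma densely_defined_linear (W : set H0) (B : operator H0) :
  densely_defined_in W B -> linear_operator B.
Proof. by move=> [s _ _ _ lin]. Qed.

Lemma bounded_pencil_of (W : set H0) M (B : 'I_M.+1 -> operator H0) (K : R) :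
  linear_subspace W -> closed W -> (forall j, densely_defined_in W (B j)) ->
  (forall j, j != ord0 -> dom (B j) = W) -> 0 <= K ->
  (forall j, j != ord0 -> (opnorm (B j) <= K%:E)%E) -> bounded_pencil W B K.
Proof.
move=> sW cW dB domB K0 BK; split=> //.
- exact: closed_seq_closed.
- by move=> j; exact: densely_defined_linear (dB j).
- by have [] := dB ord0.
- by have [] := dB ord0.
- by move=> j; have [] := dB j.
- move=> j x j0 Wx; apply: opnorm_le_bound (BK j j0) _ _.
    exact: densely_defined_linear (dB j).
  by rewrite domB.
Qed.

Lemma common_bound (I : finType) (Q : pred I) (f : I -> \bar R) :
  (forall i, Q i -> (f i < +oo)%E) ->
  exists2 K : R, 0 <= K & forall i, Q i -> (f i <= K%:E)%E.
Proof.
move=> foo; pose g i : R := Num.max 0 (fine (f i)).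
have g0 i : 0 <= g i by rewrite le_max lexx.
exists (\sum_(i | Q i) g i); first exact: sumr_ge0.
move=> i Qi; apply: (@le_trans _ _ (g i)%:E); last first.
  by rewrite lee_fin (bigD1 i)//= lerDl sumr_ge0.
rewrite /g; case: (f i) (foo i Qi) => [s _|//|_]; last by rewrite leNye.
by rewrite lee_fin le_max lexx orbT.
Qed.
End SpectralLimits.
Theorem theorem6p6 (R : realType)
    (* the Hilbert space H_0 *)
    (H0 : completeNormedModType (C R)) (dot : {dot H0 for conjC})
    (dot_norm : forall x : H0, `|x| ^+ 2 = dot x x)
    (* closed subspaces H, H_n and orthogonal projections P, P_n *)
    (H : set H0) (Hn : nat -> set H0)
    (H_sub : linear_subspace H) (H_closed : closed H)
    (Hn_sub : forall n, linear_subspace (Hn n))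
    (Hn_closed : forall n, closed (Hn n))
    (P : H0 -> H0) (Pn : nat -> H0 -> H0)
    (P_proj : orthogonal_projection dot H P)
    (Pn_proj : forall n, orthogonal_projection dot (Hn n) (Pn n))
    (Pn_P : strong_cvg Pn P)
    (* the coefficients A_j, A_{j,n} *)
    (M : nat) (A : 'I_M.+1 -> operator H0)
    (An : nat -> 'I_M.+1 -> operator H0)
    (A_dense : forall j, densely_defined_in H (A j))
    (An_dense : forall n j, densely_defined_in (Hn n) (An n j))
    (A_bounded : forall j, j != ord0 ->
       dom (A j) = H /\ (opnorm (A j) < +oo)%E)
    (An_dom : forall n j, j != ord0 -> dom (An n j) = Hn n)
    (An_bounded : forall j, j != ord0 ->
       (ereal_sup (range (fun n => opnorm (An n j))) < +oo)%E)
    (* the ray in the resolvent sets of A_0, A_{0,n} *)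
    (c gamma : R) (gamma_range : - pi < gamma <= pi)
    (ray_A : forall s, s < c ->
       resolvent_set H (operator_pencil (A ord0)) (ray_point gamma s))
    (ray_An : forall n s, s < c ->
       resolvent_set (Hn n) (operator_pencil (An n ord0)) (ray_point gamma s))
    (ray_A_lim :
       opnorm (inverse (operator_pencil (A ord0) (ray_point gamma s)))
         @[s --> -oo%R] --> 0%E)
    (ray_An_lim :
       ereal_sup (range (fun n =>
         opnorm (inverse (operator_pencil (An n ord0) (ray_point gamma s)))))
         @[s --> -oo%R] --> 0%E) :
  let T := pencil A in
  let Tn := fun n => pencil (An n) in
  let sigma_e := limiting_essential_spectrum dot Tn
    `|` conjC @` limiting_essential_spectrum dot
                   (fun n => adjoint_pencil dot (Hn n) (Tn n)) in
  (exists lambda0 : C R,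
     [/\ forall n, resolvent_set (Hn n) (Tn n) lambda0,
         resolvent_set H T lambda0,
         strong_cvg (fun n x => inverse (Tn n lambda0) (Pn n x))
                    (fun x => inverse (T lambda0) (P x)) &
         strong_cvg
           (fun n x => adjoint dot (Hn n) (inverse (Tn n lambda0)) (Pn n x))
           (fun x => adjoint dot H (inverse (T lambda0)) (P x))]) ->
  (forall j, j != ord0 ->
     strong_cvg (fun n x => An n j (Pn n x)) (fun x => A j (P x))
     /\ strong_cvg (fun n x => adjoint dot (Hn n) (An n j) (Pn n x))
                   (fun x => adjoint dot H (A j) (P x))) ->
  spectral_pollution H Hn T Tn `<=` sigma_e
  /\ (forall lambda : C R,
        point_spectrum T lambda -> isolated (spectrum H T) lambda ->
        ~ sigma_e lambda ->
        exists2 lambdan : nat -> C R,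
          \forall n \near \oo, spectrum (Hn n) (Tn n) (lambdan n) &
          lambdan n @[n --> \oo] --> lambda).
Proof.
move=> T Tn sigma_e [lam0 [inv0n inv0 res radj]] coef.
have [K1 K10 bdA] := common_bound (fun j j0 => proj2 (A_bounded j j0)).
have [K2 K20 bdAn] := common_bound An_bounded.
have K0 : 0 <= K1 + K2 by exact: addr_ge0.
have bA : bounded_pencil H A (K1 + K2).
  apply: bounded_pencil_of => // j j0; first by have [] := A_bounded j j0.
  by apply: le_trans (bdA j j0) _; rewrite lee_fin lerDl.
have bAn n : bounded_pencil (Hn n) (An n) (K1 + K2).
  apply: bounded_pencil_of => // j j0; first exact: An_dom.
  apply: (@le_trans _ _ K2%:E); last by rewrite lee_fin lerDr.
  by apply: le_trans (bdAn j j0); apply: ereal_sup_ubound; exists n.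
have cf j j0 := proj1 (coef j j0); have cfadj j j0 := proj2 (coef j j0).
have nsing lam : ~ sigma_e lam ->
    ~ approximately_singular (dot := dot) (fun n => Tn n lam) /\
    ~ approximately_singular (dot := dot) (fun n => adjoint dot (Hn n) (Tn n lam)).
  move=> nse; split=> sing; apply: nse.
    by left; exact: (singular_limiting_essential_spectrum dot_norm).
  right; exists (conjC lam); last exact: conjCK.
  apply: (singular_limiting_essential_spectrum dot_norm).
  by rewrite /adjoint_pencil conjCK.
split.
- move=> lam [invlam [lamn spec lim]]; apply: contrapT => /nsing[ns nsadj].
  by have [] := no_pollution dot_norm H_sub Hn_sub P_proj Pn_proj Pn_P bA bAn
    inv0 inv0n res cf radj cfadj invlam lim spec.
- move=> lam [x x0 [dx Tx]] [_ [V Vlam Visol]] /nsing[ns _].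
  have [r1 r10 Vr] : exists2 r1 : R, 0 < r1 & forall mu, nrm (mu - lam) < r1 -> V mu.
    move/nbhs_ballP: Vlam => [e /= e0 eV].
    move: e0; rewrite ltcE /= => /andP[/eqP eI eR].
    exists (complex.Re e) => // mu mue; apply: eV; rewrite -ball_normE /= nrmE.
    by rewrite nrm_distC; case: e eI eR mue => a b /= -> _; rewrite ltc_real.
  apply: (@select_spectral_points R (fun n => spectrum (Hn n) (Tn n))).
  apply: (eigenvalue_approximation dot_norm H_sub Hn_sub P_proj Pn_proj Pn_P bA bAn
    inv0 inv0n res cf radj cfadj dx x0 Tx r10 _ ns).
  move=> mu mul mur; apply: contrapT => nmu.
  have : (V `&` spectrum H T) mu by split; [exact: Vr|exact: nmu].
  by rewrite Visol => mu_lam; move: mul; rewrite mu_lam eqxx.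
Qed.
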